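(* Let $\lambda>0$ be known, let $f$ be a probability density on $\mathbb{R}$, and let $X_1,X_2,\ldots$ be i.i.d. copies of $X=Y+Z$, where $Y=\sum_{j=1}^{N(\lambda)}W_j$ with $N(\lambda)$ Poisson distributed with parameter $\lambda$, $W_1,W_2,\ldots$ i.i.d. with density $f$, $Z$ standard normal, and $N(\lambda)$, $(W_j)_j$, $Z$ independent. Let the kernel $w$ be the sinc kernel $w(x)=(\sin x)/(\pi x)$, with Fourier transform $\phi_w=1_{[-1,1]}$, and let the bandwidth $h=h_n>0$ satisfy $h_n\sim(\log n)^{-\beta}$ as $n\to\infty$, where $0<\beta<1/2$. Assume $\operatorname{E}[|X|]<\infty$. Then, with probability tending to $1$ as $n\to\infty$, the distinguished logarithm $$\operatorname{Log}\left(\frac{\phi_{emp}(t)\phi_w(ht)}{e^{-\lambda}e^{-t^2/2}}\right),\qquad t\in[-1/h,1/h],$$ is well-defined. Moreover, let $\delta>0$ be a fixed, sufficiently small constant and let $B_{nh}$ be the event $$B_{nh}=\left\{\sup_{t\in[-1/h,1/h]}e^{1/(2h^2)}\left|\frac{\phi_{emp}(t)}{e^{-\lambda}}-\frac{\phi_X(t)}{e^{-\lambda}}\right|>\delta\right\}.$$ If $\operatorname{E}[|X|^\rho]<\infty$ for some $1<\rho<2$, then $$\operatorname{P}(B_{nh})=O\left(\frac{1}{n^{\rho-1}}\right)\quad\text{as } n\to\infty,$$ and if $\operatorname{E}[|X|^\rho]<\infty$ for some $\rho\ge2$, then $$\operatorname{P}(B_{nh})=O\left(\frac{1}{n^{\rho/2}}\right)\quad\text{as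 } n\to\infty.$$
   Context: An empty sum is $0$. $\phi_X(t)=\operatorname{E}[e^{itX}]=e^{-\lambda+\lambda\phi_f(t)}e^{-t^2/2}$ is the characteristic function of $X$, where $\phi_f(t)=\int_{-\infty}^\infty e^{itx}f(x)\,dx$, and $\phi_{emp}(t)=\frac1n\sum_{j=1}^n e^{itX_j}$ is the empirical characteristic function. The distinguished logarithm is well-defined for an outcome $\omega$ when $t\mapsto\frac{\phi_{emp}(t)\phi_w(ht)}{e^{-\lambda}e^{-t^2/2}}$ does not vanish on $[-1/h,1/h]$; it is then the unique continuous function $L$ on $[-1/h,1/h]$ with $e^{L(t)}=\frac{\phi_{emp}(t)\phi_w(ht)}{e^{-\lambda}e^{-t^2/2}}$ and $L(0)=\lambda$. ''$\delta$ sufficiently small'' means: small enough (depending only on $\lambda$) that on the complement $B_{nh}^c$ the function $\phi_{emp}(t)e^{\lambda}e^{t^2/2}$ is bounded away from zero on $[-1/h,1/h]$, so that the distinguished logarithm is well-defined on $B_{nh}^c$; e.g. $\delta<e^{-\lambda}$ (note $|\phi_X(t)e^{\lambda}e^{t^2/2}|=|e^{\lambda\phi_f(t)}|\ge e^{-\lambda}$). *)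

(* Defs.v *)
From mathcomp Require Import all_boot all_order all_algebra finmap.
From mathcomp Require Import complex ring.
From mathcomp Require Import all_classical all_reals all_analysis.

Set Implicit Arguments.
Unset Strict Implicit.
Unset Printing Implicit Defensive.

Import Order.TTheory GRing.Theory Num.Theory.
Import numFieldNormedType.Exports.

Local Open Scope classical_set_scope.
Local Open Scope complex_scope.
Local Open Scope ring_scope.

Definition modc (R : realType) (z : R[i]) : R := ComplexField.Normc.normc z.

Definition cexp (R : realType) (z : R[i]) : R[i] :=
  (expR (complex.Re z))%:C * (cos (complex.Im z) +i* sin (complex.Im z)).

Definition cexpect d (T : measurableType d) (R : realType)
    (P : probability T R) (Y : T -> R[i]) : R[i] :=
  fine 'E_P[fun w => complex.Re (Y w)] +i* fine 'E_P[fun w => complex.Im (Y w)].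

Definition char_fun d (T : measurableType d) (R : realType)
    (P : probability T R) (X : T -> R) (t : R) : R[i] :=
  cexpect P (fun w => cexp ('i%C * (t * X w)%:C)).

(* The observations X_1, ..., X_n are x 0, ..., x n.-1. *)
Definition emp_char_fun (R : realType) (x : nat -> R) (n : nat) (t : R) : R[i] :=
  n%:R^-1 * \sum_(j < n) cexp ('i%C * (t * x j)%:C).

Definition is_density (R : realType) (f : R -> R) : Prop :=
  [/\ measurable_fun setT f, forall x, 0 <= f x
    & (\int[lebesgue_measure]_x (f x)%:E = 1)%E].

Definition has_density d (T : measurableType d) (R : realType)
    (P : probability T R) (X : {RV P >-> R}) (f : R -> R) : Prop :=
  forall A : set R, measurable A ->
    distribution P X A = (\int[lebesgue_measure]_(x in A) (f x)%:E)%E.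

Definition mutually_independent d (T : measurableType d) (R : realType)
    (P : probability T R) (I : choiceType) (F : I -> set_system T) : Prop :=
  forall (J : {fset I}) (A : I -> set T),
    (forall i, i \in J -> F i (A i)) ->
    P (\bigcap_(i in [set` J]) A i) = (\prod_(i <- J) P (A i))%E.

(* X is the prototype: it may live on another probability space. *)
Definition iid_copies d (T : measurableType d) d0 (T0 : measurableType d0)
    (R : realType) (P : probability T R) (P0 : probability T0 R)
    (Xs : nat -> {RV P >-> R}) (X : T0 -> R) : Prop :=
  mutually_independent P (fun j => g_sigma_algebra_preimage (Xs j)) /\
  forall j (A : set R), measurable A -> P (Xs j @^-1` A) = P0 (X @^-1` A).

Definition gauss_compound_sum (T : Type) (R : realType)
    (N : T -> nat) (W : nat -> T -> R) (Z : T -> R) (w : T) : R :=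
  \sum_(j < N w) W j w + Z w.

Definition gauss_compound_poisson_model d (T : measurableType d) (R : realType)
    (P : probability T R) (lam : R) (f : R -> R) (N : {RV P >-> nat})
    (W : nat -> {RV P >-> R}) (Z : {RV P >-> R}) : Prop :=
  [/\ forall k, P (N @^-1` [set k]) = (poisson_pmf lam k)%:E,
      mutually_independent P (fun j => g_sigma_algebra_preimage (W j)) /\
        (forall j, has_density (W j) f),
      forall A : set R, measurable A -> distribution P Z A = normal_prob 0 1 A
    & mutually_independent P (fun i : 'I_3 =>
        nth set0 [:: g_sigma_algebra_preimage N;
                     <<s \bigcup_j g_sigma_algebra_preimage (W j) >>;
                     g_sigma_algebra_preimage Z] i)].

(* The division at x = 0, a null set, gives 0 instead of the limit 1 / pi. *)
Definition sinc_kernel (R : realType) (x : R) : R := sin x / (pi * x).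

(* sinc_kernel is not Lebesgue integrable, so its Fourier transform is taken in
   the L^2 sense: sinc_ft is the function whose inverse transform is sinc_kernel
   (sinc_kernelE), with the value 1 at the endpoints -1 and 1. *)
Definition sinc_ft (R : realType) : R -> R := \1_`[(-1 : R), 1].

Definition dlog_arg (R : realType) (lam h : R) (x : nat -> R) (n : nat) (t : R)
    : R[i] :=
  emp_char_fun x n t * (sinc_ft (h * t))%:C /
    (expR (- lam) * expR (- (t ^+ 2 / 2)))%:C.

(* ^o gives R[i] the topology of the modulus. *)
Definition is_dlog (R : realType) (g : R -> R[i]) (c r : R)
    (L : R -> R[i]^o) : Prop :=
  [/\ {within `[- r, r], continuous L},
      forall t : R, t \in `[- r, r] -> cexp (L t) = g t
    & L 0 = c%:C].

Definition dlog_well_defined (R : realType) (g : R -> R[i]) (c r : R) : Prop :=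
  (forall t : R, t \in `[- r, r] -> g t != 0) /\
  exists L, is_dlog g c r L /\
    forall L', is_dlog g c r L' -> forall t : R, t \in `[- r, r] -> L' t = L t.

Definition dlog_event d (T : measurableType d) (R : realType)
    (P : probability T R) (Xs : nat -> {RV P >-> R}) (lam : R) (h : nat -> R)
    (n : nat) : set T :=
  [set w | dlog_well_defined (dlog_arg lam (h n) (Xs ^~ w) n) lam (h n)^-1].

Definition B_event d (T : measurableType d) (R : realType)
    (P : probability T R) (Xs : nat -> {RV P >-> R}) (phiX : R -> R[i])
    (lam delta : R) (h : nat -> R) (n : nat) : set T :=
  [set w | (delta%:E < ereal_sup
    [set (expR (1 / (2 * h n ^+ 2)) *
          modc (emp_char_fun (Xs ^~ w) n t / (expR (- lam))%:C
                - phiX t / (expR (- lam))%:C))%R%:E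
    | t in `[(- (h n)^-1)%R, ((h n)^-1)%R]])%E].

(* Off B, the empirical characteristic function times e^lam e^{t^2/2} stays away
   from zero: the requirement that "delta sufficiently small" stands for. *)
Definition small_delta d (T : measurableType d) (R : realType)
    (P : probability T R) (Xs : nat -> {RV P >-> R}) (phiX : R -> R[i])
    (lam : R) (h : nat -> R) (delta : R) : Prop :=
  forall n w, (0 < n)%N -> ~ B_event Xs phiX lam delta h n w ->
    exists2 c : R, 0 < c &
      forall t : R, t \in `[- (h n)^-1, (h n)^-1] ->
        c <= modc (emp_char_fun (Xs ^~ w) n t * (expR lam * expR (t ^+ 2 / 2))%:C).

Lemma sinc_kernelE (R : realType) (x : R) : x != 0 ->
  sinc_kernel x =
  (2 * pi)^-1 * \int[lebesgue_measure]_t (sinc_ft t * cos (t * x)).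
Proof.
move=> x0.
have -> : \int[lebesgue_measure]_t (sinc_ft t * cos (t * x)) =
    \int[lebesgue_measure]_(t in `[(-1 : R), 1]) cos (t * x).
  rewrite [RHS]Rintegral_mkcond; apply: eq_Rintegral => t _.
  by rewrite /sinc_ft patchE indicE; case: ifP => _; rewrite ?mul1r ?mul0r.
pose F (t : R) := x^-1 * sin (t * x).
have dF (t : R) : is_derive t 1 F (cos (t * x)).
  have dl : is_derive t (1 : R) (fun s : R => s * x) x.
    have -> : (fun s : R => s * x) = x *: (@id R).
      by apply/funext => s; rewrite fctE /= mulrC.
    by apply: is_derive_eq; rewrite /GRing.scale /= mulr1.
  have := is_deriveZ x^-1 (@is_derive1_comp R sin (fun s : R => s * x) t _ _ _ dl).
  move=> /(_ _ (is_derive_sin _)) H.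
  by apply: (is_derive_eq H); rewrite /GRing.scale /= mulrCA mulVf // mulr1.
have cF (t : R) : {for t, continuous F}.
  by apply/differentiable_continuous/derivable1_diffP; case: (dF t).
rewrite /Rintegral (@continuous_FTC2 _ _ F).
- rewrite -EFinB /= /F mulNr !mul1r sinN /sinc_kernel.
  have := lt0r_neq0 (pi_gt0 R); move: (pi : R) => p p0.
  by field; rewrite x0.
- by rewrite -subr_gt0 opprK addr_gt0.
- apply: continuous_subspaceT => t; apply: continuous_comp; last exact: continuous_cos.
  exact: mulrr_continuous.
- split; first by move=> t _; case: (dF t).
  + exact: cvg_at_right_filter (cF _).
  + exact: cvg_at_left_filter (cF _).
- by move=> t _; rewrite derive1E; case: (dF t).
Qed.

(* Main.v *)
Require Import Defs.
From mathcomp Require Import all_boot all_order all_algebra finmap.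
From mathcomp Require Import complex ring lra.
From mathcomp Require Import all_classical all_reals all_analysis.
From mathcomp Require Import measurable_realfun.

Set Implicit Arguments.
Unset Strict Implicit.
Unset Printing Implicit Defensive.
Import Order.TTheory GRing.Theory Num.Theory.
Import numFieldNormedType.Exports.

Local Open Scope classical_set_scope.
Local Open Scope ring_scope.

(** The theorem rests on a fast rate for the fluctuations of the empirical
    characteristic function, on a lower bound for [phi_X], and on the existence
    of a logarithm along a nonvanishing curve.

    Fluctuations. The probability of [B] is [O(n ^- K)] for every [K] ([B_rate]).
    At one point [t], [emp_char_fun - phi_X] is an average of [n] centred,
    bounded, independent variables, so a deviation larger than [2 eta] has
    probability at most [4 exp (- n eta ^ 2 / 32)] ([hoeffding_upper],
    [pointwise_deviation]). In [t], both functions are Lipschitz, with constants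
    twice the average of the [`|X_j|] and twice [E `|X|]; by Markov's inequality
    that average is at most [n ^ K] outside an event of probability
    [O(n ^- K)]. Hence the supremum over [-1/h, 1/h] is governed by a grid of
    polynomially many points ([uniform_deviation]). Because [2 beta < 1], the
    factor [exp (1 / (2 h ^ 2))] is at most [n ^ (1/4)]
    ([bandwidth_subpolynomial]), so the relevant [eta] is at least of order
    [n ^ (- 1/4)], and the exponential bound, [exp (- c sqrt n)], beats the number
    of grid points.

    Lower bound. Since [phi_X t = exp (- lam + lam phi_f t) exp (- t ^ 2 / 2)],
    one has [`|phi_X t| >= exp (- 2 lam) exp (- t ^ 2 / 2)] ([char_fun_lower]).
    Conditioning on [N < n] produces the partial sum of degree less than [n] of
    the exponential series at [w = lam phi_f t]. Its product with the partial sum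
    at [- w] tends to 1, while the latter is at most [exp `|w|]; this bounds the
    former from below by [exp (- lam)] in the limit ([modc_texp_lower]). The
    normal factor comes from the differential equation [G' = - t G] of
    [G t = E cos (t Z)] ([gauss_cos]). Off [B], the empirical characteristic
    function inherits the lower bound ([emp_lower_off_B]).

    Logarithm. The empirical characteristic function is Lipschitz and equals 1 at
    0, so nonvanishing on the interval is equivalent to the existence of the
    distinguished logarithm ([dlog_well_definedP]); the lift is an explicit sum of
    principal logarithms ([log_lift_exists]).

    Every passage from the law of a variable, or from independence, to
    expectations of bounded functions goes through [bounded_functional_eq0]: a
    linear functional that is continuous for the uniform norm and vanishes on
    indicators vanishes on all bounded measurable functions. *)

(** * Complex numbers in real coordinates *)

Section complex_basics.
Context {R : realType}.
Local Open Scope complex_scope.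
Implicit Types (z w : R[i]) (x y a b : R).

Definition cis x : R[i] := cos x +i* sin x.

Lemma complexP z w :
  complex.Re z = complex.Re w -> complex.Im z = complex.Im w -> z = w.
Proof. by case: z w => [a b] [c d] /= -> ->. Qed.

Lemma cReM z w : complex.Re (z * w) =
  complex.Re z * complex.Re w - complex.Im z * complex.Im w.
Proof. by case: z w => [a b] [c d]. Qed.

Lemma cImM z w : complex.Im (z * w) =
  complex.Re z * complex.Im w + complex.Im z * complex.Re w.
Proof. by case: z w => [a b] [c d]. Qed.

Lemma cReD z w : complex.Re (z + w) = complex.Re z + complex.Re w.
Proof. by case: z w => [a b] [c d]. Qed.

Lemma cImD z w : complex.Im (z + w) = complex.Im z + complex.Im w.
Proof. by case: z w => [a b] [c d]. Qed.

Lemma cReN z : complex.Re (- z) = - complex.Re z.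
Proof. by case: z. Qed.

Lemma cImN z : complex.Im (- z) = - complex.Im z.
Proof. by case: z. Qed.

Lemma cRe_sum (I : Type) (s : seq I) (F : I -> R[i]) :
  complex.Re (\sum_(i <- s) F i) = \sum_(i <- s) complex.Re (F i).
Proof. exact: (big_morph _ cReD erefl). Qed.

Lemma cIm_sum (I : Type) (s : seq I) (F : I -> R[i]) :
  complex.Im (\sum_(i <- s) F i) = \sum_(i <- s) complex.Im (F i).
Proof. exact: (big_morph _ cImD erefl). Qed.

Lemma natC n : (n%:R : R[i]) = (n%:R : R)%:C.
Proof. by rewrite rmorph_nat. Qed.

Lemma invC x : (x%:C)^-1 = (x^-1)%:C :> R[i].
Proof. by rewrite fmorphV. Qed.

Lemma cReZ a z : complex.Re (a%:C * z) = a * complex.Re z.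
Proof. by rewrite cReM /= mul0r subr0. Qed.

Lemma cImZ a z : complex.Im (a%:C * z) = a * complex.Im z.
Proof. by rewrite cImM /= mul0r addr0. Qed.

Lemma modcE z : modc z = Num.sqrt (complex.Re z ^+ 2 + complex.Im z ^+ 2).
Proof. by case: z. Qed.

Lemma sqr_modc z : modc z ^+ 2 = complex.Re z ^+ 2 + complex.Im z ^+ 2.
Proof. by rewrite modcE sqr_sqrtr // addr_ge0 // sqr_ge0. Qed.

Lemma modc_ge0 z : 0 <= modc z.
Proof. by rewrite modcE sqrtr_ge0. Qed.

Lemma modcM z w : modc (z * w) = modc z * modc w.
Proof. exact: ComplexField.Normc.normcM. Qed.

Lemma modcV z : modc z^-1 = (modc z)^-1.
Proof. exact: ComplexField.Normc.normcV. Qed.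

Lemma modcD z w : modc (z + w) <= modc z + modc w.
Proof. exact: le_normcD. Qed.

Lemma modcN z : modc (- z) = modc z.
Proof. by rewrite !modcE cReN cImN !sqrrN. Qed.

Lemma modcB z w : modc z - modc w <= modc (z - w).
Proof. by rewrite lerBlDr (le_trans _ (modcD _ _)) // subrK. Qed.

Lemma modc_distC z w : modc (z - w) = modc (w - z).
Proof. by rewrite -modcN opprB. Qed.

Lemma modc_dist z w : `|modc z - modc w| <= modc (z - w).
Proof. by rewrite ler_norml modcB andbT lerNl opprB modc_distC modcB. Qed.

Lemma modc_real x : modc x%:C = `|x|.
Proof. by rewrite modcE /= expr0n addr0 sqrtr_sqr. Qed.

Lemma modc0 : modc (0 : R[i]) = 0.
Proof. by rewrite (modc_real 0) normr0. Qed.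

Lemma modc1 : modc (1 : R[i]) = 1.
Proof. by rewrite (modc_real 1) normr1. Qed.

Lemma modc_eq0 z : (modc z == 0) = (z == 0).
Proof.
apply/eqP/eqP => [|->]; last exact: modc0.
exact: ComplexField.Normc.eq0_normc.
Qed.

Lemma modc_gt0 z : (0 < modc z) = (z != 0).
Proof. by rewrite lt_def modc_ge0 andbT modc_eq0. Qed.

Lemma modcX z n : modc (z ^+ n) = modc z ^+ n.
Proof. by elim: n => [|n IH]; rewrite ?modc1 // !exprS modcM IH. Qed.

Lemma modc_sum (I : Type) (s : seq I) (Q : pred I) (F : I -> R[i]) :
  modc (\sum_(i <- s | Q i) F i) <= \sum_(i <- s | Q i) modc (F i).
Proof.
elim/big_ind2 : _ => [|z a w b za wb|i _]; rewrite ?modc0 //.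
by rewrite (le_trans (modcD _ _)) // lerD.
Qed.

Lemma Re_le_modc z : `|complex.Re z| <= modc z.
Proof.
by rewrite modcE -sqrtr_sqr ler_wsqrtr // lerDl sqr_ge0.
Qed.

Lemma Im_le_modc z : `|complex.Im z| <= modc z.
Proof.
by rewrite modcE -sqrtr_sqr ler_wsqrtr // lerDr sqr_ge0.
Qed.

Lemma modc_le_ReIm z : modc z <= `|complex.Re z| + `|complex.Im z|.
Proof.
rewrite modcE -[leRHS]ger0_norm ?addr_ge0 // -sqrtr_sqr ler_wsqrtr //.
rewrite sqrrD !real_normK ?num_real //.
by rewrite addrAC lerDl mulrn_wge0 // mulr_ge0.
Qed.

Lemma cisD x y : cis (x + y) = cis x * cis y.
Proof. by apply: complexP; rewrite ?cReM ?cImM /= ?cosD ?sinD //; ring. Qed.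

Lemma cis0 : cis 0 = 1.
Proof. by rewrite /cis cos0 sin0. Qed.

Lemma cis_sum (I : Type) (s : seq I) (F : I -> R) :
  cis (\sum_(i <- s) F i) = \prod_(i <- s) cis (F i).
Proof. exact: (big_morph _ cisD cis0). Qed.

Lemma modc_cis x : modc (cis x) = 1.
Proof. by rewrite modcE /= cos2Dsin2 sqrtr1. Qed.

Lemma cexpE z : cexp z = (expR (complex.Re z))%:C * cis (complex.Im z).
Proof. by []. Qed.

Lemma cexp_itx t x : cexp ('i%C * (t * x)%:C) = cis (t * x).
Proof.
rewrite cexpE cReM cImM /= mulr0 mul0r subr0 mul1r mul0r add0r expR0.
by rewrite mul1r.
Qed.

Lemma cexpD z w : cexp (z + w) = cexp z * cexp w.
Proof. by rewrite !cexpE cReD cImD expRD cisD rmorphM /=; ring. Qed.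

Lemma cexp0 : cexp (0 : R[i]) = 1.
Proof. by rewrite cexpE /= expR0 cis0 mulr1. Qed.

Lemma cexp_sum (I : Type) (s : seq I) (F : I -> R[i]) :
  cexp (\sum_(i <- s) F i) = \prod_(i <- s) cexp (F i).
Proof. exact: (big_morph _ cexpD cexp0). Qed.

Lemma cexp_real x : cexp x%:C = (expR x)%:C.
Proof. by rewrite cexpE /= cis0 mulr1. Qed.

Lemma cos_lipschitz x y : `|cos x - cos y| <= `|x - y|.
Proof.
wlog xy : x y / y <= x.
  move=> H; have [/H//|/ltW/H] := leP y x.
  by rewrite distrC (distrC x).
have [||c _ ->] := @MVT_segment R cos (fun u => - sin u) y x => //.
- exact/continuous_subspaceT/continuous_cos.
- by rewrite normrM normrN ler_piMl // sin_max.
Qed.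

Lemma sin_lipschitz x y : `|sin x - sin y| <= `|x - y|.
Proof.
wlog xy : x y / y <= x.
  move=> H; have [/H//|/ltW/H] := leP y x.
  by rewrite distrC (distrC x).
have [||c _ ->] := @MVT_segment R sin cos y x => //.
- exact/continuous_subspaceT/continuous_sin.
- by rewrite normrM ler_piMl // cos_max.
Qed.

Lemma cis_lipschitz x y : modc (cis x - cis y) <= 2 * `|x - y|.
Proof.
rewrite (le_trans (modc_le_ReIm _)) // cReD cImD cReN cImN /= mulr_natl mulr2n.
by rewrite lerD // ?cos_lipschitz ?sin_lipschitz.
Qed.

End complex_basics.

(** * Bounded random variables and independence *)

Section bounded_measurable.
Context d (T : measurableType d) {R : realType}.
Implicit Types f g : T -> R.

Definition bmeas f := measurable_fun setT f /\ exists M : R, forall x, `|f x| <= M.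

Lemma bmeas_cst c : bmeas (fun=> c).
Proof. by split; [exact: measurable_cst|exists `|c|]. Qed.

Lemma bmeasD f g : bmeas f -> bmeas g -> bmeas (fun x => f x + g x).
Proof.
move=> [mf [M fM]] [mg [N gN]]; split; first exact: measurable_funD.
by exists (M + N) => x; rewrite (le_trans (ler_normD _ _)) // lerD.
Qed.

Lemma bmeasM f g : bmeas f -> bmeas g -> bmeas (fun x => f x * g x).
Proof.
move=> [mf [M fM]] [mg [N gN]]; split; first exact: measurable_funM.
by exists (M * N) => x; rewrite normrM ler_pM.
Qed.

Lemma bmeasZ c f : bmeas f -> bmeas (fun x => c * f x).
Proof. exact/bmeasM/bmeas_cst. Qed.

Lemma bmeasN f : bmeas f -> bmeas (fun x => - f x).
Proof. by move=> /(bmeasZ (-1)); under eq_fun do rewrite mulN1r. Qed.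

Lemma bmeasB f g : bmeas f -> bmeas g -> bmeas (fun x => f x - g x).
Proof. by move=> bf bg; apply: bmeasD => //; exact: bmeasN. Qed.

Lemma bmeas_indic (A : set T) : measurable A -> bmeas (\1_A : T -> R).
Proof.
move=> mA; split; first exact: measurable_indic.
by exists 1 => x; rewrite indicE; case: (x \in A); rewrite ?normr1 ?normr0.
Qed.

Lemma bmeas_sum (I : Type) (s : seq I) (F : I -> T -> R) :
  (forall i, bmeas (F i)) -> bmeas (fun x => \sum_(i <- s) F i x).
Proof.
move=> bF; elim: s => [|i s IH].
  by under eq_fun do rewrite big_nil; exact: bmeas_cst.
by under eq_fun do rewrite big_cons; exact: bmeasD.
Qed.

Lemma bmeas_prod (I : Type) (s : seq I) (F : I -> T -> R) :
  (forall i, bmeas (F i)) -> bmeas (fun x => \prod_(i <- s) F i x).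
Proof.
move=> bF; elim: s => [|i s IH].
  by under eq_fun do rewrite big_nil; exact: bmeas_cst.
by under eq_fun do rewrite big_cons; exact: bmeasM.
Qed.

Lemma bmeas_comp d' (T' : measurableType d') (V : T' -> T) f :
  measurable_fun setT V -> bmeas f ->
  measurable_fun setT (fun x => f (V x)) /\
    exists M : R, forall x, `|f (V x)| <= M.
Proof.
move=> mV [mf [M fM]]; split; first exact: measurableT_comp.
by exists M.
Qed.

(** In the approximation below, [y] is a rescaled value of the function and the
    sum counts the levels that lie below it. *)
Lemma count_le_real (k : nat) (y : R) : 0 <= y -> y <= k%:R ->
  `|y - \sum_(j < k) (j.+1%:R <= y)%R%:R| <= 1.
Proof.
move=> y0 yk.
have [H1 H2] : (y < k%:R -> y - 1 <= \sum_(j < k) (j.+1%:R <= y)%R%:R <= y) /\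
    (k%:R <= y -> \sum_(j < k) (j.+1%:R <= y)%R%:R = k%:R :> R).
  elim: k {yk} => [|k [IH1 IH2]].
    by split => [/(le_lt_trans y0)|_]; rewrite ?ltxx // big_ord0.
  split => [yk|ky]; rewrite big_ord_recr /=; last first.
    by rewrite ky IH2 ?natr1 //; apply: le_trans ky; rewrite ler_nat.
  have -> : (k.+1%:R <= y) = false by rewrite leNgt yk.
  rewrite addr0; have [/IH1//|ky] := ltP y k%:R.
  by rewrite IH2 // ky andbT; move: yk; rewrite -natr1; lra.
move: yk; rewrite le_eqVlt => /orP[/eqP yk|/H1 /andP[? ?]].
  by rewrite H2 ?yk // subrr normr0.
by rewrite ler_norml; apply/andP; split; lra.
Qed.

(** Bounded measurable functions are uniform limits of linear combinations of
    indicators: rescaled to have values in [0, 1], such a function is within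
    [1 / k] of the average of the indicators of its upper level sets at the
    heights [1 / k, ..., k / k]. *)
Lemma bounded_functional_eq0 (L : (T -> R) -> R) (K : R) :
  (forall a f g, bmeas f -> bmeas g ->
    L (fun x => a * f x + g x) = a * L f + L g) ->
  (forall f M, bmeas f -> (forall x, `|f x| <= M) -> `|L f| <= K * M) ->
  (forall A, measurable A -> L \1_A = 0) ->
  forall g, bmeas g -> L g = 0.
Proof.
move=> Llin Lbd Lind g bg; have [mg [M0 gM0]] := bg.
pose M := `|M0| + 1.
have M_gt0 : 0 < M by rewrite ltr_pwDr.
have gM x : `|g x| <= M.
  by rewrite (le_trans (gM0 x)) // (le_trans (ler_norm _)) // lerDl.
pose u x := (2 * M)^-1 * g x + 2^-1.
have bu : bmeas u by apply: bmeasD; [exact: bmeasZ|exact: bmeas_cst].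
have Lcst c : L (fun=> c) = 0.
  have := Llin c \1_setT \1_set0 (bmeas_indic measurableT) (bmeas_indic measurable0).
  rewrite !Lind // mulr0 addr0 => <-; congr L; apply/funext => x.
  by rewrite indicT indic0 mulr1 addr0.
suff Lu : L u = 0.
  have -> : g = (fun x => (2 * M) * u x + - M).
    by apply/funext => x; rewrite /u; field; rewrite gt_eqF.
  by rewrite Llin ?Lu ?Lcst ?mulr0 ?addr0 //; exact: bmeas_cst.
have u01 x : 0 <= u x <= 1.
  have := gM x; rewrite ler_norml => /andP[g1 g2].
  have i0 : 0 < (2 * M)^-1 by rewrite invr_gt0 mulr_gt0.
  have e : (2 * M)^-1 * M = 2^-1 by field; rewrite gt_eqF.
  have := ler_wpM2l (ltW i0) g1; have := ler_wpM2l (ltW i0) g2.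
  by rewrite /u mulrN e => ? ?; apply/andP; split; lra.
have K0 : 0 <= K.
  have := Lbd (fun=> 1) 1 (bmeas_cst 1).
  rewrite mulr1 => H; apply: le_trans (H _); first exact: normr_ge0.
  by move=> _; rewrite normr1.
pose s k x := \sum_(j < k) \1_[set x | j.+1%:R <= k%:R * u x] x : R.
have mlev (j k : nat) : measurable [set x | j.+1%:R <= k%:R * u x].
  have [mku _] := bmeasZ k%:R bu.
  have := measurable_fun_le measurableT (measurable_cst (j.+1%:R : R)) mku.
  by rewrite setTI.
have Lsum (k : nat) (A : nat -> set T) : (forall j, measurable (A j)) ->
    bmeas (fun x => \sum_(j < k) \1_(A j) x : R) /\
    L (fun x => \sum_(j < k) \1_(A j) x) = 0.
  move=> mA; split; first by apply: bmeas_sum => j; exact: bmeas_indic.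
  elim: k => [|k IH].
    by under eq_fun do rewrite big_ord0; exact: Lcst.
  have -> : (fun x => \sum_(j < k.+1) \1_(A j) x) =
      (fun x => 1 * \1_(A k) x + \sum_(j < k) \1_(A j) x) :> (T -> R).
    by apply/funext => x; rewrite big_ord_recr /= mul1r addrC.
  rewrite Llin ?IH ?Lind ?mulr0 ?addr0 //; first exact: bmeas_indic.
  by apply: bmeas_sum => j; exact: bmeas_indic.
have Luk (k : nat) : `|L u| <= K / k.+1%:R.
  have [bs Ls] := Lsum k.+1 (fun j => [set x | j.+1%:R <= k.+1%:R * u x])
                   (fun j => mlev j k.+1).
  have := Llin (- k.+1%:R^-1) _ u bs bu; rewrite Ls mulr0 add0r => <-.
  apply: Lbd; first by apply: bmeasD => //; exact: bmeasZ.
  move=> x; have k0 : 0 < k.+1%:R^-1 :> R by rewrite invr_gt0.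
  rewrite -[leRHS]mulr1.
  have -> : - k.+1%:R^-1 * (\sum_(j < k.+1) \1_[set x | j.+1%:R <= k.+1%:R * u x] x)
      + u x = k.+1%:R^-1 * (k.+1%:R * u x -
        \sum_(j < k.+1) (j.+1%:R <= k.+1%:R * u x)%R%:R).
    rewrite mulrBr mulKf ?pnatr_eq0 // addrC mulNr; congr (_ - _ * _).
    apply: eq_bigr => j _; rewrite indicE; congr (nat_of_bool _)%:R.
    by apply/idP/idP; rewrite inE.
  rewrite normrM gtr0_norm // ler_pM2l //.
  have /andP[u0 u1] := u01 x.
  by apply: count_le_real; [exact: mulr_ge0|rewrite ler_piMr].
apply/eqP; rewrite -normr_le0 leNgt; apply/negP => L0.
have := Luk (Num.truncn (K / `|L u|)).
rewrite ler_pdivlMr // mulrC -ler_pdivlMr //.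
by rewrite leNgt truncnS_gt.
Qed.

End bounded_measurable.

Section bounded_expectation.
Context d (T : measurableType d) {R : realType} (P : probability T R).
Local Open Scope complex_scope.
Implicit Types (f g : T -> R) (Y Z : T -> R[i]).

Lemma bmeas_integrable f : bmeas f -> P.-integrable setT (EFin \o f).
Proof.
move=> [mf [M fM]]; apply: measurable_bounded_integrable => //.
- by rewrite (le_lt_trans (probability_le1 _ _)) ?ltry.
- exists M; split; first exact: num_real.
  by move=> y My x _; rewrite /= (le_trans (fM x)) ?ltW.
Qed.

Lemma fine_expectation f : fine 'E_P[f] = \int[P]_x f x.
Proof. by rewrite unlock. Qed.

Lemma prob_cst (c : R) : \int[P]_x c = c.
Proof. by rewrite Rintegral_cst //= probability_setT mulr1. Qed.

Lemma bmeas_intlin a f g : bmeas f -> bmeas g ->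
  \int[P]_x (a * f x + g x) = a * \int[P]_x f x + \int[P]_x g x.
Proof.
move=> bf bg; rewrite RintegralD ?RintegralZl //; apply: bmeas_integrable => //.
exact: bmeasZ.
Qed.

Lemma bmeas_intD f g : bmeas f -> bmeas g ->
  \int[P]_x (f x + g x) = \int[P]_x f x + \int[P]_x g x.
Proof. by move=> bf bg; rewrite RintegralD //; exact: bmeas_integrable. Qed.

Lemma bmeas_intB f g : bmeas f -> bmeas g ->
  \int[P]_x (f x - g x) = \int[P]_x f x - \int[P]_x g x.
Proof. by move=> bf bg; rewrite RintegralB //; exact: bmeas_integrable. Qed.

Lemma bmeas_intZ c f : bmeas f -> \int[P]_x (c * f x) = c * \int[P]_x f x.
Proof. by move=> bf; rewrite RintegralZl //; exact: bmeas_integrable. Qed.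

Lemma le_bmeas_int f g : bmeas f -> bmeas g -> (forall x, f x <= g x) ->
  \int[P]_x f x <= \int[P]_x g x.
Proof. by move=> bf bg fg; apply: le_Rintegral => //; exact: bmeas_integrable. Qed.

Lemma norm_bmeas_int f (M : R) : bmeas f -> (forall x, `|f x| <= M) ->
  `|\int[P]_x f x| <= M.
Proof.
move=> bf fM; rewrite ler_norml.
have H1 := le_bmeas_int (@bmeas_cst _ T R (- M)) bf.
have H2 := le_bmeas_int bf (@bmeas_cst _ T R M).
rewrite !prob_cst in H1 H2; apply/andP; split; [apply: H1|apply: H2] => x;
by have := fM x; rewrite ler_norml => /andP[].
Qed.

Lemma int_indic (A : set T) : measurable A -> \int[P]_x \1_A x = fine (P A).
Proof. by move=> mA; rewrite /Rintegral integral_indic // setIT. Qed.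

Definition cbmeas Y :=
  bmeas (fun x => complex.Re (Y x)) /\ bmeas (fun x => complex.Im (Y x)).

Lemma cbmeas_cst z : cbmeas (fun=> z).
Proof. by split; exact: bmeas_cst. Qed.

Lemma cbmeas_real f : bmeas f -> cbmeas (fun x => (f x)%:C).
Proof. by move=> bf; split => //=; exact: bmeas_cst. Qed.

Lemma cbmeasD Y Z : cbmeas Y -> cbmeas Z -> cbmeas (fun x => Y x + Z x).
Proof.
move=> [Y1 Y2] [Z1 Z2]; split; [under eq_fun do rewrite cReD|under eq_fun do rewrite cImD].
- exact: bmeasD.
- exact: bmeasD.
Qed.

Lemma cbmeasB Y Z : cbmeas Y -> cbmeas Z -> cbmeas (fun x => Y x - Z x).
Proof.
move=> [Y1 Y2] [Z1 Z2]; split.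
- by under eq_fun do rewrite cReD cReN; exact: bmeasB.
- by under eq_fun do rewrite cImD cImN; exact: bmeasB.
Qed.

Lemma cbmeasM Y Z : cbmeas Y -> cbmeas Z -> cbmeas (fun x => Y x * Z x).
Proof.
move=> [Y1 Y2] [Z1 Z2]; split.
- under eq_fun do rewrite cReM; apply: bmeasB; exact: bmeasM.
- under eq_fun do rewrite cImM; apply: bmeasD; exact: bmeasM.
Qed.

Lemma cbmeas_prod (I : Type) (s : seq I) (F : I -> T -> R[i]) :
  (forall i, cbmeas (F i)) -> cbmeas (fun x => \prod_(i <- s) F i x).
Proof.
move=> bF; elim: s => [|i s IH].
  by under eq_fun do rewrite big_nil; exact: cbmeas_cst.
by under eq_fun do rewrite big_cons; exact: cbmeasM.
Qed.

Lemma cbmeas_sum (I : Type) (s : seq I) (F : I -> T -> R[i]) :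
  (forall i, cbmeas (F i)) -> cbmeas (fun x => \sum_(i <- s) F i x).
Proof.
move=> bF; elim: s => [|i s IH].
  by under eq_fun do rewrite big_nil; exact: cbmeas_cst.
by under eq_fun do rewrite big_cons; exact: cbmeasD.
Qed.

Lemma bmeas_cos f : measurable_fun setT f -> bmeas (fun x => cos (f x)).
Proof.
move=> mf; split; last by exists 1 => x; exact: cos_max.
exact: (measurableT_comp (continuous_measurable_fun (@continuous_cos R))).
Qed.

Lemma bmeas_sin f : measurable_fun setT f -> bmeas (fun x => sin (f x)).
Proof.
move=> mf; split; last by exists 1 => x; exact: sin_max.
exact: (measurableT_comp (continuous_measurable_fun (@continuous_sin R))).
Qed.

Lemma cbmeas_cis f : measurable_fun setT f -> cbmeas (fun x => cis (f x)).
Proof. by move=> mf; split; [exact: bmeas_cos|exact: bmeas_sin]. Qed.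

Lemma cexpectE Y : cexpect P Y =
  (\int[P]_x complex.Re (Y x)) +i* (\int[P]_x complex.Im (Y x)).
Proof. by rewrite /cexpect !fine_expectation. Qed.

Lemma cexpect_cst z : cexpect P (fun=> z) = z.
Proof. by rewrite cexpectE !prob_cst; case: z. Qed.

Lemma cexpect_real f : cexpect P (fun x => (f x)%:C) = (\int[P]_x f x)%:C.
Proof. by rewrite cexpectE /= prob_cst. Qed.

Lemma cexpectD Y Z : cbmeas Y -> cbmeas Z ->
  cexpect P (fun x => Y x + Z x) = cexpect P Y + cexpect P Z.
Proof.
move=> [Y1 Y2] [Z1 Z2]; rewrite !cexpectE.
under eq_Rintegral do rewrite cReD.
under [X in _ +i* X]eq_Rintegral do rewrite cImD.
by rewrite !bmeas_intD.
Qed.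

Lemma cexpectB Y Z : cbmeas Y -> cbmeas Z ->
  cexpect P (fun x => Y x - Z x) = cexpect P Y - cexpect P Z.
Proof.
move=> [Y1 Y2] [Z1 Z2]; rewrite !cexpectE.
under eq_Rintegral do rewrite cReD cReN.
under [X in _ +i* X]eq_Rintegral do rewrite cImD cImN.
by rewrite !bmeas_intB.
Qed.

Lemma cexpect_sum (I : Type) (s : seq I) (F : I -> T -> R[i]) :
  (forall i, cbmeas (F i)) ->
  cexpect P (fun x => \sum_(i <- s) F i x) = \sum_(i <- s) cexpect P (F i).
Proof.
move=> bF; elim: s => [|i s IH].
  by rewrite big_nil -[RHS]cexpect_cst; congr cexpect; apply/funext => x; rewrite big_nil.
rewrite big_cons -IH -cexpectD //; last exact: cbmeas_sum.
by congr cexpect; apply/funext => x; rewrite big_cons.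
Qed.

(** Rotating [Y] so that its expectation becomes a nonnegative real number
    reduces the bound to the monotonicity of the real integral. *)
Lemma modc_cexpect Y (b : T -> R) : cbmeas Y -> P.-integrable setT (EFin \o b) ->
  (forall x, modc (Y x) <= b x) -> modc (cexpect P Y) <= \int[P]_x b x.
Proof.
move=> [Y1 Y2] bb Yb; set z := cexpect P Y.
have b0 x : 0 <= b x by exact: (le_trans (modc_ge0 (Y x)) (Yb x)).
have [->|z0] := eqVneq z 0.
  by rewrite modc0; apply: Rintegral_ge0.
rewrite -modc_gt0 in z0; rewrite -(ler_pM2l z0) -expr2 sqr_modc.
have -> : complex.Re z ^+ 2 + complex.Im z ^+ 2 =
    \int[P]_x (complex.Re z * complex.Re (Y x) + complex.Im z * complex.Im (Y x)).
  rewrite bmeas_intlin //; last exact: bmeasZ.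
  by rewrite bmeas_intZ // /z cexpectE.
rewrite -RintegralZl //; apply: le_Rintegral => //; last first.
- move=> x _; apply: (@le_trans _ _ (modc z * modc (Y x)));
    last by rewrite ler_wpM2l ?modc_ge0.
  have -> : complex.Re z * complex.Re (Y x) + complex.Im z * complex.Im (Y x) =
      complex.Re (z * (complex.Re (Y x) -i* complex.Im (Y x))).
    by rewrite cReM /= mulrN opprK.
  rewrite (le_trans (ler_norm _)) // (le_trans (Re_le_modc _)) // modcM.
  by rewrite ler_wpM2l ?modc_ge0 // !modcE /= sqrrN.
- exact: (integrableZl measurableT (modc z) bb).
- by apply: bmeas_integrable; apply: bmeasD; exact: bmeasZ.
Qed.

End bounded_expectation.

Section independence.
Context d (T : measurableType d) {R : realType} (P : probability T R).
Local Open Scope complex_scope.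

(** A bounded factor [H] that is uncorrelated with every event in terms of [V]
    is uncorrelated with every bounded function of [V]: both sides are linear in
    that function and continuous for the uniform norm. *)
Lemma indep_step_real (H V : T -> R) (c : R) (g : R -> R) :
  bmeas H -> measurable_fun setT V -> bmeas g ->
  (forall A, measurable A -> \int[P]_x (H x * \1_A (V x)) = c * \int[P]_x \1_A (V x)) ->
  \int[P]_x (H x * g (V x)) = c * \int[P]_x g (V x).
Proof.
move=> bH mV bg HA.
have bc (f : R -> R) : bmeas f -> bmeas (fun x => f (V x)) by exact: bmeas_comp.
pose L f := \int[P]_x (H x * f (V x)) - c * \int[P]_x f (V x).
apply/eqP; rewrite -subr_eq0; apply/eqP.
have [_ [M HM]] := bH.
apply: (@bounded_functional_eq0 _ _ _ L (M + `|c|)) => //.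
- move=> a f1 f2 b1 b2; rewrite /L bmeas_intlin; [|exact: bc..].
  under eq_Rintegral do rewrite mulrDr mulrCA.
  by rewrite bmeas_intlin; [ring|apply: bmeasM => //; exact: bc..].
- move=> f N bf fN; rewrite /L (le_trans (ler_normB _ _)) // mulrDl.
  have N0 x : 0 <= N := le_trans (normr_ge0 _) (fN x).
  rewrite lerD // ?normrM ?ler_wpM2l //.
    apply: norm_bmeas_int; first by apply: bmeasM => //; exact: bc.
    by move=> x; rewrite normrM ler_pM.
  by apply: norm_bmeas_int => //; exact: bc.
- by move=> A mA; rewrite /L HA // subrr.
Qed.

Lemma indep_step (H : T -> R[i]) (V : T -> R) (c : R[i]) (g : R -> R[i]) :
  cbmeas H -> measurable_fun setT V -> cbmeas g ->
  (forall A, measurable A -> cexpect P (fun x => H x * (\1_A (V x))%:C) =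
     c * cexpect P (fun x => (\1_A (V x))%:C)) ->
  cexpect P (fun x => H x * g (V x)) = c * cexpect P (fun x => g (V x)).
Proof.
move=> [H1 H2] mV [g1 g2] HA.
have bc (f : R -> R) : bmeas f -> bmeas (fun x => f (V x)) by exact: bmeas_comp.
have b1 := bc (fun y => complex.Re (g y)) g1.
have b2 := bc (fun y => complex.Im (g y)) g2.
have HRe A : measurable A ->
    \int[P]_x (complex.Re (H x) * \1_A (V x)) = complex.Re c * \int[P]_x \1_A (V x).
  move=> /HA/(congr1 (@complex.Re R)); rewrite cReM cexpect_real !cexpectE /= mulr0 subr0.
  move=> <-; apply: eq_Rintegral => x _.
  by rewrite cReM /= mulr0 subr0.
have HIm A : measurable A ->
    \int[P]_x (complex.Im (H x) * \1_A (V x)) = complex.Im c * \int[P]_x \1_A (V x).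
  move=> /HA/(congr1 (@complex.Im R)); rewrite cImM cexpect_real !cexpectE /= mulr0 add0r.
  move=> <-; apply: eq_Rintegral => x _.
  by rewrite cImM /= mulr0 add0r.
apply: complexP; rewrite ?cReM ?cImM !cexpectE /=.
- under eq_Rintegral do rewrite cReM.
  rewrite bmeas_intB; [|exact: bmeasM..].
  by rewrite (indep_step_real (g := fun y => complex.Re (g y)) H1 mV g1 HRe)
    (indep_step_real (g := fun y => complex.Im (g y)) H2 mV g2 HIm).
- under eq_Rintegral do rewrite cImM.
  rewrite bmeas_intD; [|exact: bmeasM..].
  by rewrite (indep_step_real (g := fun y => complex.Im (g y)) H1 mV g2 HRe)
    (indep_step_real (g := fun y => complex.Re (g y)) H2 mV g1 HIm).
Qed.

Variables (I : choiceType) (F : I -> set_system T) (V : I -> T -> R).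
Hypotheses (indF : mutually_independent P F)
  (mV : forall i, measurable_fun setT (V i))
  (VF : forall i A, measurable A -> F i (V i @^-1` A)).

Lemma indep_indic (s : seq I) (A : I -> set R) : uniq s ->
  (forall i, measurable (A i)) ->
  cexpect P (fun x => \prod_(i <- s) (\1_(A i) (V i x))%:C) =
  \prod_(i <- s) cexpect P (fun x => (\1_(A i) (V i x))%:C).
Proof.
move=> us mA.
have mVA i : measurable (V i @^-1` A i).
  by rewrite -[X in measurable X]setTI; exact: mV.
have := indF (J := [fset i in s]%fset) (A := fun i => V i @^-1` A i)
  (fun i _ => VF i (mA i)).
have -> : \prod_(i <- s) cexpect P (fun x => (\1_(A i) (V i x))%:C) =
    (\prod_(i <- s) \int[P]_x \1_(A i) (V i x))%:C.
  by rewrite rmorph_prod; apply: eq_bigr => i _; exact: cexpect_real.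
have -> : (fun x => \prod_(i <- s) (\1_(A i) (V i x))%:C) =
    (fun x => (\prod_(i <- s) \1_(A i) (V i x))%:C) :> (T -> R[i]).
  by apply/funext => x; rewrite rmorph_prod.
rewrite cexpect_real => Hind; congr _%:C.
have -> : \int[P]_x \prod_(i <- s) \1_(A i) (V i x) =
    fine (P (\bigcap_(i in [set` [fset i in s]%fset]) (V i @^-1` A i))).
  rewrite -int_indic; last first.
    by apply: fin_bigcap_measurable => // i _; exact: mVA.
  apply: eq_Rintegral => x _; rewrite indicE.
  have [/set_mem xin|/negP xin] := boolP (x \in _).
    rewrite big_seq big1 // => i si; rewrite indicE mem_set //.
    by apply: xin; rewrite /= !inE.
  suff /hasP[i si /negbTE ix] : has (fun i => V i x \notin A i) s.
    rewrite (big_rem i) //= indicE ix mul0r //.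
  rewrite has_predC; apply/negP => /allP H; apply: xin.
  by apply: mem_set => i /=; rewrite !inE => /H; rewrite inE.
have -> : \prod_(i <- s) \int[P]_x \1_(A i) (V i x) =
    \prod_(i <- s) fine (P (V i @^-1` A i)).
  apply: eq_bigr => i _; rewrite -int_indic //.
rewrite Hind (perm_big s) /=; last first.
  by rewrite uniq_perm ?fset_uniq // => i; rewrite !inE.
elim: (s) => [|i s' IH]; rewrite ?big_nil // !big_cons fineM ?IH //.
- exact: fin_num_measure.
- by rewrite prode_fin_num // => j _; exact: fin_num_measure.
Qed.

(** One factor at a time, the indicators in the product rule for events are
    replaced by the bounded functions [g i]. *)
Lemma indep_mixed (g : I -> R -> R[i]) (A : I -> set R) (s1 s2 : seq I) :
  (forall i, cbmeas (g i)) -> (forall i, measurable (A i)) ->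
  uniq (s1 ++ s2) ->
  cexpect P (fun x => \prod_(i <- s1) g i (V i x) *
                      \prod_(i <- s2) (\1_(A i) (V i x))%:C) =
  \prod_(i <- s1) cexpect P (fun x => g i (V i x)) *
  \prod_(i <- s2) cexpect P (fun x => (\1_(A i) (V i x))%:C).
Proof.
move=> bg; elim: s1 s2 A => [|i s1 IH] s2 A mA us.
  under eq_fun do rewrite big_nil mul1r.
  by rewrite big_nil mul1r indep_indic.
have bc (f : R -> R[i]) j : cbmeas f -> cbmeas (fun x => f (V j x)).
  by move=> [f1 f2]; split; [exact: (bmeas_comp (mV j) f1)|exact: (bmeas_comp (mV j) f2)].
have b1 B : measurable B -> cbmeas (fun y : R => (\1_B y)%:C : R[i]).
  by move=> mB; apply: cbmeas_real; exact: bmeas_indic.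
have -> : (fun x => \prod_(i <- i :: s1) g i (V i x) *
                      \prod_(i <- s2) (\1_(A i) (V i x))%:C) =
    (fun x => (\prod_(i <- s1) g i (V i x) *
      \prod_(i <- s2) (\1_(A i) (V i x))%:C) * g i (V i x)).
  by apply/funext => x; rewrite big_cons; ring.
rewrite (@indep_step _ (V i) (\prod_(i <- s1) cexpect P (fun x => g i (V i x)) *
  \prod_(i <- s2) cexpect P (fun x => (\1_(A i) (V i x))%:C)) (g i)) //.
- by rewrite big_cons; ring.
- apply: cbmeasM.
    exact: (@cbmeas_prod _ T R I s1 (fun j x => g j (V j x)) (fun j => bc _ j (bg j))).
  exact: (@cbmeas_prod _ T R I s2 (fun j x => (\1_(A j) (V j x))%:C)
    (fun j => bc _ j (b1 _ (mA j)))).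
move=> B mB.
have ni : i \notin s2.
  by move: us; rewrite /= mem_cat negb_or => /andP[/andP[]].
have := IH (i :: s2) (fun j => if j == i then B else A j).
rewrite !big_cons eqxx.
have eqA (f : I -> set R -> R[i]) : \prod_(j <- s2) f j (if j == i then B else A j)
    = \prod_(j <- s2) f j (A j).
  rewrite !big_seq; apply: eq_bigr => j js; case: eqP => // ji.
  by rewrite -ji js in ni.
under eq_fun do rewrite big_cons eqxx (eqA (fun j C => (\1_C (V j _))%:C)).
rewrite (eqA (fun j C => cexpect P (fun x => (\1_C (V j x))%:C))).
move=> H; rewrite [RHS]mulrAC -mulrA -H.
- by congr cexpect; apply/funext => x; ring.
- by move=> j; case: eqP.
- by rewrite uniq_catC /= mem_cat negb_or ni uniq_catC; move: us => /=;
  rewrite mem_cat negb_or => /andP[/andP[-> _]].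
Qed.

(** The case where no indicator is left. *)
Lemma indep_cexpect_prod (g : I -> R -> R[i]) (s : seq I) :
  (forall i, cbmeas (g i)) -> uniq s ->
  cexpect P (fun x => \prod_(i <- s) g i (V i x)) =
  \prod_(i <- s) cexpect P (fun x => g i (V i x)).
Proof.
move=> bg us; have := @indep_mixed g (fun=> setT) s [::] bg (fun=> measurableT).
rewrite cats0 big_nil mulr1 => /(_ us) <-.
by congr cexpect; apply/funext => x; rewrite big_nil mulr1.
Qed.

End independence.

Lemma same_law_int (R : realType) d (T : measurableType d) (P : probability T R)
    d' (T' : measurableType d') (P' : probability T' R)
    (V : T -> R) (V' : T' -> R) (g : R -> R) :
  measurable_fun setT V -> measurable_fun setT V' -> bmeas g ->
  (forall A : set R, measurable A -> P (V @^-1` A) = P' (V' @^-1` A)) ->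
  \int[P]_x g (V x) = \int[P']_x g (V' x).
Proof.
move=> mV mV' bg VV'.
pose L (f : R -> R) := \int[P]_x f (V x) - \int[P']_x f (V' x).
apply/eqP; rewrite -subr_eq0; apply/eqP.
have bc (f : R -> R) : bmeas f -> bmeas (fun x => f (V x)) by exact: bmeas_comp.
have bc' (f : R -> R) : bmeas f -> bmeas (fun x => f (V' x)) by exact: bmeas_comp.
apply: (@bounded_functional_eq0 _ _ _ L 2) => //.
- move=> a f1 f2 b1 b2; rewrite /L bmeas_intlin; [|exact: bc..].
  by rewrite bmeas_intlin; [ring|exact: bc'..].
- move=> f N bf fN; rewrite /L (le_trans (ler_normB _ _)) // mulr_natl mulr2n.
  rewrite lerD // norm_bmeas_int //; [exact: bc|exact: bc'].
- move=> A mA; apply/eqP; rewrite /L subr_eq0; apply/eqP.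
  have mVA : measurable (V @^-1` A) by rewrite -[X in measurable X]setTI; exact: mV.
  have mVA' : measurable (V' @^-1` A) by rewrite -[X in measurable X]setTI; exact: mV'.
  rewrite -[LHS]/(\int[P]_x \1_(V @^-1` A) x) -[RHS]/(\int[P']_x \1_(V' @^-1` A) x).
  by rewrite !int_indic // VV'.
Qed.

Lemma same_law_ge0_integral (R : realType) d (T : measurableType d) (P : probability T R)
    d' (T' : measurableType d') (P' : probability T' R)
    (V : T -> R) (V' : T' -> R) (g : R -> \bar R) :
  measurable_fun setT V -> measurable_fun setT V' ->
  measurable_fun setT g -> (forall y, 0 <= g y)%E ->
  (forall A : set R, measurable A -> P (V @^-1` A) = P' (V' @^-1` A)) ->
  (\int[P]_x g (V x) = \int[P']_x g (V' x))%E.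
Proof.
move=> mV mV' mg g0 VV'.
pose X : {RV P >-> R} := MeasurableFun.Pack
  (MeasurableFun.Class (isMeasurableFun.Build _ _ _ _ V mV)).
pose X' : {RV P' >-> R} := MeasurableFun.Pack
  (MeasurableFun.Class (isMeasurableFun.Build _ _ _ _ V' mV')).
have H := ge0_integral_distribution X mg g0.
have H' := ge0_integral_distribution X' mg g0.
rewrite -[LHS]H -[RHS]H'; apply: eq_measure_integral => A mA _.
exact: VV'.
Qed.

Lemma big_iota0 (S : Type) (idx : S) (op : S -> S -> S) (n : nat) (f : nat -> S) :
  \big[op/idx]_(i <- iota 0 n) f i = \big[op/idx]_(i < n) f i.
Proof. by rewrite -(big_mkord xpredT f) /index_iota subn0. Qed.

(** * Exponential concentration of bounded averages *)

(** [expR y <= 1 / (1 - y)], and the polynomial on the right, multiplied by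
    [1 - y], is at least 1 as long as [y <= 1 / 2]. *)
Lemma expR_le_quadratic (R : realType) (y : R) :
  y <= 1 / 2 -> expR y <= 1 + y + 2 * y ^+ 2.
Proof.
move=> y2; have y1 : 0 < 1 - y by lra.
rewrite -(ler_pM2r y1); apply: (@le_trans _ _ (expR y * expR (- y))).
  by rewrite ler_pM2l ?expR_gt0 // (le_trans _ (expR_ge1Dx _)).
rewrite expRN divff ?gt_eqF ?expR_gt0 //.
have -> : (1 + y + 2 * y ^+ 2) * (1 - y) = 1 + y ^+ 2 * (1 - 2 * y) by ring.
by rewrite lerDl mulr_ge0 ?sqr_ge0 //; lra.
Qed.

Lemma sqr_le4 (R : realType) (u : R) : `|u| <= 2 -> u ^+ 2 <= 4.
Proof. by rewrite ler_norml => /andP[? ?]; nra. Qed.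

Section hoeffding.
Context d (T : measurableType d) {R : realType} (P : probability T R).
Variables (F : nat -> set_system T) (V : nat -> T -> R).
Hypotheses (indF : mutually_independent P F)
  (mV : forall i, measurable_fun setT (V i))
  (VF : forall i A, measurable A -> F i (V i @^-1` A)).

Lemma indep_int_prod (g : R -> R) (n : nat) : bmeas g ->
  \int[P]_x (\prod_(i < n) g (V i x)) = \prod_(i < n) \int[P]_x g (V i x).
Proof.
move=> bg; have := @indep_cexpect_prod _ _ _ P _ _ _ indF mV VF
  (fun _ y => (g y)%:C%C) (iota 0 n) (fun=> cbmeas_real bg) (iota_uniq 0 n).
have -> : (fun x => (\prod_(i <- iota 0 n) (g (V i x))%:C)%C) =
   (fun x => ((\prod_(i < n) g (V i x))%:C)%C) :> (T -> R[i]).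
  by apply/funext => x; rewrite rmorph_prod big_iota0.
have -> : (\prod_(i <- iota 0 n) cexpect P (fun x => (g (V i x))%:C%C)) =
    (\prod_(i < n) \int[P]_x g (V i x))%:C%C.
  by rewrite rmorph_prod big_iota0; apply: eq_bigr => i _; exact: cexpect_real.
by rewrite cexpect_real => -[].
Qed.

(** Chernoff's method with parameter [eta / 16]: a centred variable bounded by
    2 has moment generating function at most [1 + 8 s ^ 2 <= exp (8 s ^ 2)] at
    [s <= 1 / 4], and [8 s ^ 2 - s * eta] is then [- eta ^ 2 / 32]. *)
Lemma hoeffding_upper (g : R -> R) (m eta : R) (n : nat) :
  measurable_fun setT g -> (forall y, `|g y| <= 1) ->
  (forall j, \int[P]_x g (V j x) = m) -> 0 <= eta -> eta <= 4 ->
  fine (P [set x | n%:R * eta <= \sum_(j < n) (g (V j x) - m)]) <=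
  expR (- (n%:R * eta ^+ 2 / 32)).
Proof.
move=> mg g1 gm eta0 eta4.
have bg : bmeas g by split => //; exists 1.
have m1 : `|m| <= 1.
  by rewrite -(gm 0); apply: norm_bmeas_int => //; exact: bmeas_comp (mV 0) bg.
pose s := eta / 16.
pose G y := expR (s * (g y - m)).
have gm2 (y : R) : `|g y - m| <= 2 :> R.
  by rewrite (le_trans (ler_normB _ _)) // -[leRHS]/(1 + 1) lerD.
have s0 : 0 <= s by rewrite /s divr_ge0.
have sy y : s * (g y - m) <= 1 / 2.
  have := gm2 y; rewrite ler_norml => /andP[_ h].
  by rewrite (le_trans (ler_wpM2l s0 h)) // /s; lra.
have bgm : bmeas (fun y => g y - m) by apply: bmeasB => //; exact: bmeas_cst.
have bG : bmeas G.
  split; last first.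
    by exists (expR (1 / 2)) => y; rewrite ger0_norm ?expR_ge0 // ler_expR.
  apply: (measurableT_comp (@measurable_expR R)).
  by case: (bmeasZ s bgm).
have bc (f : R -> R) j : bmeas f -> bmeas (fun x => f (V j x)).
  exact: bmeas_comp.
have EG j : \int[P]_x G (V j x) <= expR (8 * s ^+ 2).
  apply: (@le_trans _ _ (\int[P]_x (s * (g (V j x) - m) + (1 + 8 * s ^+ 2)))).
    apply: le_bmeas_int; first exact: bc.
      apply: bmeasD; last exact: bmeas_cst.
      apply: bmeasZ; apply: bmeasB; last exact: bmeas_cst.
      exact: bc.
    move=> x; rewrite /G (le_trans (expR_le_quadratic (sy _))) //.
    have : ((g (V j x) - m) ^+ 2 <= 4 :> R)%R.
      exact: sqr_le4.
    have aux (p q r : R) : q <= r * 4 -> 1 + p + 2 * q <= p + (1 + 8 * r) by lra.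
    by move=> /(ler_wpM2l (sqr_ge0 s)) h; rewrite exprMn; exact: aux.
  rewrite bmeas_intlin; last exact: bmeas_cst.
    rewrite bmeas_intB; [|exact: bc|exact: bmeas_cst].
    rewrite gm !prob_cst subrr mulr0 add0r.
    by rewrite (le_trans _ (expR_ge1Dx _)).
  by apply: bmeasB; [exact: bc|exact: bmeas_cst].
set A := [set x | _].
have mA : measurable A.
  have := measurable_fun_le measurableT (measurable_cst (n%:R * eta))
    (@measurable_sum _ T R setT _ (index_enum 'I_n) (fun j x => g (V j x) - m) _).
  rewrite setTI; apply => j; apply: measurable_funB => //.
  exact: measurableT_comp.
rewrite -int_indic //.
apply: (@le_trans _ _ (\int[P]_x (expR (- (s * (n%:R * eta))) *
    \prod_(i < n) G (V i x)))).
  apply: le_bmeas_int; first exact: bmeas_indic.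
    apply: bmeasZ; apply: (@bmeas_prod _ T R _ _ (fun (i : 'I_n) x => G (V i x))).
    by move=> i; exact: bc.
  move=> x; rewrite /G -expR_sum -expRD -mulr_sumr -mulrN -mulrDr indicE.
  have [/set_mem|_] := boolP (x \in A); last exact: expR_ge0.
  rewrite /A /= => h; rewrite -[X in X <= _]expR0 ler_expR mulr_ge0 //.
  by rewrite addrC subr_ge0.
rewrite bmeas_intZ; last first.
  apply: (@bmeas_prod _ T R _ _ (fun (i : 'I_n) x => G (V i x))).
  by move=> i; exact: bc.
rewrite indep_int_prod //.
apply: (@le_trans _ _ (expR (- (s * (n%:R * eta))) * \prod_(i < n) expR (8 * s ^+ 2))).
  rewrite ler_wpM2l ?expR_ge0 //; apply: ler_prod => i _; rewrite EG andbT.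
  by apply: Rintegral_ge0 => x _; exact: expR_ge0.
rewrite -expR_sum -expRD ler_expR sumr_const card_ord /s -mulr_natr.
by rewrite le_eqVlt; apply/orP; left; apply/eqP; field.
Qed.

End hoeffding.

(** * The cosine transform of the standard normal law *)

Section gaussian.
Context {R : realType}.
Notation mu := (@lebesgue_measure R).

Definition std_pdf (x : R) : R := normal_pdf 0 1 x.

Lemma std_pdfE (x : R) : std_pdf x = normal_peak 1 * expR (- (x ^+ 2 / 2)).
Proof.
by rewrite /std_pdf normal_pdfE ?oner_eq0 // /normal_fun subr0 expr1n mulNr.
Qed.

Lemma std_pdf_ge0 x : 0 <= std_pdf x. Proof. exact: normal_pdf_ge0. Qed.

Lemma std_pdfN x : std_pdf (- x) = std_pdf x.
Proof. by rewrite !std_pdfE sqrrN. Qed.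

Lemma is_derive_lin (t x : R) : is_derive x (1 : R) (fun s : R => t * s) t.
Proof.
have -> : (fun s : R => t * s) = t *: (@id R) by apply/funext => s; rewrite fctE.
by apply: is_derive_eq; rewrite /GRing.scale /= mulr1.
Qed.

Lemma is_derive_halfsqr (c x : R) :
  is_derive x (1 : R) (fun y => expR (c * (y ^+ 2 / 2))) (c * x * expR (c * (x ^+ 2 / 2))).
Proof.
have h : is_derive x (1 : R) (fun y => c * (y ^+ 2 / 2)) (c * x).
  have -> : (fun y : R => c * (y ^+ 2 / 2)) = (c / 2) *: ((@id R) ^+ 2).
    by apply/funext => s; rewrite !fctE /GRing.scale /= mulrA mulrAC -mulrA.
  by apply: is_derive_eq; rewrite /GRing.scale /= expr1 !mulr1; field.
have := @is_derive1_comp R expR _ x _ _ (is_derive_expR _) h.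
by move=> H; apply: (is_derive_eq H); rewrite mulrC.
Qed.

Lemma is_derive_std_pdf (x : R) : is_derive x (1 : R) std_pdf (- x * std_pdf x).
Proof.
have -> : std_pdf = normal_peak 1 *: (fun y => expR (- 1 * (y ^+ 2 / 2))).
  by apply/funext => y; rewrite fctE /GRing.scale /= std_pdfE mulN1r.
have := is_deriveZ (normal_peak 1) (is_derive_halfsqr (- 1) x).
by move=> H; apply: (is_derive_eq H); rewrite fctE /GRing.scale /= mulN1r; ring.
Qed.

Lemma is_derive_cosl (t x : R) :
  is_derive x (1 : R) (fun s : R => cos (t * s)) (- (t * sin (t * x))).
Proof.
have H := @is_derive1_comp R cos _ x _ _ (is_derive_cos _) (is_derive_lin t x).
by apply: (is_derive_eq H); rewrite mulrC mulrN.
Qed.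

Lemma is_derive_sinl (t x : R) :
  is_derive x (1 : R) (fun s : R => sin (t * s)) (t * cos (t * x)).
Proof.
have H := @is_derive1_comp R sin _ x _ _ (is_derive_sin _) (is_derive_lin t x).
by apply: (is_derive_eq H); rewrite mulrC.
Qed.

Lemma continuous_std_pdf : continuous std_pdf.
Proof. exact: continuous_normal_pdf. Qed.

Lemma integrable_std_pdf : mu.-integrable setT (EFin \o std_pdf).
Proof. exact: integrable_normal_pdf. Qed.

Lemma bmeas_integrable_std_pdf (g : R -> R) : bmeas g ->
  mu.-integrable setT (EFin \o (fun x => g x * std_pdf x)).
Proof.
move=> [mg [M gM]].
have mg' : measurable_fun [set: measurableTypeR R] (g : measurableTypeR R -> R) by exact: mg.
have bg : [bounded g x | x in setT].
  exists M; split; first exact: num_real.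
  by move=> y My x _; rewrite /= (le_trans (gM x)) ?ltW.
exact: (integrableMr (@measurableT _ (measurableTypeR R)) mg' bg integrable_std_pdf).
Qed.

Lemma std_pdf_cvg0 : std_pdf x @[x --> +oo] --> (0 : R).
Proof.
have -> : std_pdf = (fun x => normal_peak 1 * expR (- (x ^+ 2 / 2))).
  by apply/funext => x; rewrite std_pdfE.
rewrite -[X in _ --> X](mulr0 (normal_peak (1 : R))); apply: cvgMl_tmp.
apply: (@cvg_comp _ _ _ (fun x : R => x ^+ 2 / 2) (fun x => expR (- x))).
  by apply: gt0_cvgMly; [rewrite invr_gt0|exact: cvgr_expr2].
exact: cvgr_expR.
Qed.

Lemma integrable_absx_std_pdf :
  mu.-integrable setT (EFin \o (fun x => `|x| * std_pdf x)).
Proof.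
have cf : continuous (fun x : R => `|x| * std_pdf x).
  move=> x; apply: cvgM; [exact: norm_continuous|exact: continuous_std_pdf].
have mf : measurable_fun setT (fun x : R => `|x| * std_pdf x).
  exact: continuous_measurable_fun.
have f0 (x : R) : 0 <= `|x| * std_pdf x by rewrite mulr_ge0 // std_pdf_ge0.
apply/integrableP; split; first exact/measurable_EFinP.
under eq_integral do rewrite /= ger0_norm //.
rewrite ge0_symfun_integralT //; last by move=> x /=; rewrite normrN std_pdfN.
rewrite -set_itvcy.
under eq_integral => x.
  rewrite inE /= in_itv /= andbT => x0; rewrite (ger0_norm x0); over.
rewrite (@ge0_continuous_FTC2y _ _ (fun x => - std_pdf x) 0 0) ?ltry //.
- by move=> x x0; rewrite mulr_ge0 // std_pdf_ge0.
- apply: continuous_subspaceT => x; apply: cvgM; first exact: cvg_id.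
  exact: continuous_std_pdf.
- by rewrite -oppr0; apply: cvgN; exact: std_pdf_cvg0.
- by move=> x _; have [] := is_deriveN (is_derive_std_pdf x).
- by apply: cvgN; apply: cvg_at_right_filter; exact: continuous_std_pdf.
- move=> x _; rewrite derive1E; have [_ ->] := is_deriveN (is_derive_std_pdf x).
  by rewrite mulNr opprK.
Qed.

Lemma continuous_ibp (t : R) :
  continuous (fun x : R => (x * sin (t * x) - t * cos (t * x)) * std_pdf x).
Proof.
move=> x; apply: cvgM; last exact: continuous_std_pdf.
apply: cvgB.
  apply: cvgM; first exact: cvg_id.
  by apply/differentiable_continuous/derivable1_diffP; case: (is_derive_sinl t x).
apply: cvgMl_tmp.
by apply/differentiable_continuous/derivable1_diffP; case: (is_derive_cosl t x).
Qed.

Lemma integrable_ibp (t : R) : mu.-integrable setT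
  (EFin \o (fun x => (x * sin (t * x) - t * cos (t * x)) * std_pdf x)).
Proof.
have cf := @continuous_ibp t.
have mf := continuous_measurable_fun cf.
apply: (@le_integrable _ _ _ mu setT measurableT _
  (EFin \o (fun x => `|x| * std_pdf x + `|t| * std_pdf x))).
- exact/measurable_EFinP.
- move=> x _; rewrite /= lee_fin -mulrDl [leRHS]ger0_norm; last first.
    by rewrite mulr_ge0 ?std_pdf_ge0 // addr_ge0.
  rewrite normrM (ger0_norm (std_pdf_ge0 _)) ler_wpM2r ?std_pdf_ge0 //.
  rewrite (le_trans (ler_normB _ _)) // !normrM lerD // ler_piMr //.
  - exact: sin_max.
  - exact: cos_max.
- have it := @bmeas_integrable_std_pdf (fun=> `|t|) (bmeas_cst _ _).
  have := integrableD (@measurableT _ (measurableTypeR R)) integrable_absx_std_pdf it.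
  by apply: eq_integrable.
Qed.

(** The integrand is the derivative of [x |-> - sin (t x) std_pdf x], which vanishes
    at infinity. *)
Lemma gauss_by_parts (t : R) :
  \int[mu]_x ((x * sin (t * x) - t * cos (t * x)) * std_pdf x) = 0.
Proof.
pose f x := (x * sin (t * x) - t * cos (t * x)) * std_pdf x.
pose F x := - (sin (t * x) * std_pdf x).
have dF (x : R) : is_derive x (1 : R) F (f x).
  have H := is_deriveN (is_deriveM (is_derive_sinl t x) (is_derive_std_pdf x)).
  by apply: (is_derive_eq H); rewrite /GRing.scale /= /f; ring.
have cF : continuous F.
  by move=> x; apply/differentiable_continuous/derivable1_diffP; case: (dF x).
have if_ := integrable_ibp t; rewrite -/f in if_.
have /integrableP[mf _] := if_.
pose D n : set R := `[- n.+1%:R, n.+1%:R]%classic.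
have cf : continuous f := @continuous_ibp t.
have intD n : (\int[mu]_(x in D n) (f x)%:E = (F n.+1%:R - F (- n.+1%:R))%:E)%E.
  rewrite (@continuous_FTC2 _ f F) ?EFinB //.
  - by rewrite -subr_gt0 opprK addr_gt0.
  - exact: continuous_subspaceT.
  - split; first by move=> x _; case: (dF x).
    + exact: cvg_at_right_filter (cF _).
    + exact: cvg_at_left_filter (cF _).
  - by move=> x _; rewrite derive1E; case: (dF x).
have mD n : measurable (D n : set (measurableTypeR R)) by exact: measurable_itv.
have mfD n : measurable_fun setT ((EFin \o f) \_ (D n)).
  by apply/(measurable_restrictT _ (mD n)); exact: measurable_funTS.
have cvD : {ae mu, forall x, setT x ->
    ((EFin \o f) \_ (D n)) x @[n --> \oo] --> (EFin \o f) x}.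
  apply: aeW => x _; apply: cvg_near_cst.
  near=> n; rewrite patchE mem_set // /D /= in_itv /= -ler_norml.
  rewrite (@le_trans _ _ n%:R) ?ler_nat //.
  by near: n; exact: nbhs_infty_ger.
have leD : {ae mu, forall x n, setT x ->
    (`|((EFin \o f) \_ (D n)) x| <= (abse \o (EFin \o f)) x)%E}.
  by apply: aeW => x n _; rewrite patchE /=; case: ifP => _ //; rewrite abse0.
have [_ _] := @dominated_convergence _ _ _ mu setT measurableT
  (fun n => (EFin \o f) \_ (D n)) (EFin \o f) (abse \o (EFin \o f))
  mfD mf cvD (integrable_abse if_) leD.
have -> : [sequence (\int[mu]_x (((EFin \o f) \_ (D n)) x))%E]_n =
    (fun n => (F n.+1%:R - F (- n.+1%:R))%:E).
  by apply/funext => n; rewrite /= -intD [RHS]integral_mkcond.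
move=> cv.
have cv0 : (F n.+1%:R - F (- n.+1%:R))%:E @[n --> \oo] --> 0%:E.
  apply: cvg_EFin; first exact: nearW.
  have ph : (fun n => 2 * std_pdf n.+1%:R) @ \oo --> (0 : R).
    rewrite -[X in _ --> X](mulr0 2); apply: cvgMl_tmp.
    have cn : (n.+1%:R : R) @[n --> \oo] --> +oo.
      have -> : (fun n => n.+1%:R : R) = arithmetic 1 1.
        by apply/funext => n; rewrite /= -natr1 addrC.
      exact/cvg_arithmetic/ltr01.
    exact: (cvg_comp _ _ cn std_pdf_cvg0).
  apply: norm_cvg0.
  apply: (@squeeze_cvgr _ _ _ _ (cst 0) _ _ _ _ _ ph); last exact: cvg_cst.
  apply: nearW => n; rewrite normr_ge0 /= /F mulrN sinN std_pdfN mulNr opprK -opprD.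
  rewrite normrN (_ : _ + _ = 2 * (sin (t * n.+1%:R) * std_pdf n.+1%:R)); last by ring.
  rewrite normrM ger0_norm // ler_pM2l //.
  by rewrite normrM (ger0_norm (std_pdf_ge0 _)) ler_piMl ?std_pdf_ge0 // sin_max.
by rewrite /Rintegral (cvg_unique _ cv cv0).
Unshelve. all: by end_near. Qed.

(** [G t = E cos (t Z)] solves [G' = - t G] by the integration by parts above. *)
Lemma gauss_cos (t : R) :
  \int[mu]_x (cos (t * x) * std_pdf x) = expR (- (t ^+ 2 / 2)).
Proof.
pose G t := \int[mu]_x (cos (t * x) * std_pdf x).
have bcos u : bmeas (fun x : R => cos (u * x)).
  by apply: bmeas_cos; exact: measurable_funM.
have intc u := bmeas_integrable_std_pdf (bcos u).
have dG (u : R) : is_derive u (1 : R) G (- (u * G u)).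
  pose f s x := cos (s * x) * std_pdf x.
  have d1 s x : is_derive s (1 : R) (f ^~ x) (- (x * sin (s * x)) * std_pdf x).
    have -> : f ^~ x = std_pdf x *: (fun s => cos (x * s)).
      by apply/funext => y; rewrite fctE /GRing.scale /= /f mulrC (mulrC y).
    have H := is_deriveZ (std_pdf x) (is_derive_cosl x s).
    by apply: (is_derive_eq H); rewrite /GRing.scale /= mulrC (mulrC x s).
  have uI : `](u - 1), (u + 1)[%classic u.
    by rewrite /= in_itv /=; apply/andP; split; lra.
  have P1 s x : partial1of2 f s x = - (x * sin (s * x)) * std_pdf x.
    by rewrite partial1of2E; case: (d1 s x).
  have bd0 (x : R) : 0 <= `|x| * std_pdf x by rewrite mulr_ge0 // std_pdf_ge0.
  have bd s x : `](u - 1), (u + 1)[%classic s -> setT x ->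
      `|partial1of2 f s x| <= `|x| * std_pdf x.
    move=> _ _; rewrite P1 normrM normrN normrM (ger0_norm (std_pdf_ge0 x)).
    by rewrite ler_wpM2r ?std_pdf_ge0 // ler_piMr // sin_max.
  have dv s x : `](u - 1), (u + 1)[%classic s -> setT x -> derivable (f ^~ x) s 1.
    by move=> _ _; case: (d1 s x).
  have H := @cvg_differentiation_under_integral R _ (measurableTypeR R) mu f setT
    measurableT u (u - 1) (u + 1) uI (fun x _ => intc x) dv
    (fun x => `|x| * std_pdf x) bd0 integrable_absx_std_pdf bd.
  have E : \int[mu]_x partial1of2 f u x = - (u * G u).
    pose q x := (x * sin (u * x) - u * cos (u * x)) * std_pdf x.
    have -> : \int[mu]_x partial1of2 f u x =
        \int[mu]_x (- u * (cos (u * x) * std_pdf x) - q x).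
      by apply: eq_Rintegral => x _; rewrite P1 /q; ring.
    rewrite RintegralB //; last 2 first.
    - exact: (integrableZl (@measurableT _ (measurableTypeR R)) (- u) (intc u)).
    - exact: integrable_ibp.
    by rewrite RintegralZl // gauss_by_parts subr0 mulNr.
  rewrite E in H.
  have H' : h^-1 *: (G (h *: 1 + u) - G u) @[h --> 0^'] --> - (u * G u).
    by under eq_fun do rewrite scaler1.
  split; first by apply/cvg_ex; exists (- (u * G u)).
  exact: cvg_lim H'.
have dGe (u : R) : is_derive u (1 : R) (G * (fun y => expR (1 * (y ^+ 2 / 2)))) 0.
  have H := is_deriveM (dG u) (is_derive_halfsqr 1 u).
  by apply: (is_derive_eq H); rewrite /GRing.scale /=; ring.
have := is_derive_0_is_cst t 0 dGe; rewrite !fctE expr0n mul0r mulr0 expR0 mulr1.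
rewrite {2}/G; under [in X in _ = X -> _]eq_Rintegral do rewrite mul0r cos0 mul1r.
rewrite [X in _ = X](_ : _ = 1); last by rewrite /Rintegral integral_normal_pdf.
rewrite mul1r -/(G t) => GE; apply: (mulIf (lt0r_neq0 (expR_gt0 (t ^+ 2 / 2)))).
by rewrite GE -expRD addNr expR0.
Qed.

End gaussian.

(** * Partial sums of the exponential series *)

Section truncated_exponential.

Definition texp (K : numFieldType) (n : nat) (z : K) : K :=
  \sum_(k < n) z ^+ k / k`!%:R.

Lemma sum_antidiagonal (V : nmodType) (n : nat) (f : nat -> nat -> V) :
  \sum_(i < n) \sum_(j < n - i) f i j = \sum_(m < n) \sum_(i < m.+1) f i (m - i)%N.
Proof.
elim: n => [|n IH]; first by rewrite !big_ord0.
rewrite [RHS]big_ord_recr /= -IH [LHS]big_ord_recr /=.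
rewrite [\sum_(i < n.+1) _]big_ord_recr /= addrA -big_split /= subSnn subnn.
rewrite big_ord1; congr (_ + _); apply: eq_bigr => i _.
by rewrite subSn ?(ltnW (ltn_ord i)) // big_ord_recr.
Qed.

(** The terms of degree less than [n] in the product of two partial sums
    recombine, by the binomial formula, into a partial sum. *)
Lemma texpM (K : numFieldType) (n : nat) (x y : K) :
  texp n x * texp n y = texp n (x + y) +
    \sum_(i < n) \sum_(n - i <= j < n) y ^+ i / i`!%:R * (x ^+ j / j`!%:R).
Proof.
rewrite mulrC /texp big_distrl /=.
pose f i j : K := y ^+ i / i`!%:R * (x ^+ j / j`!%:R).
have E (i : 'I_n) : y ^+ i / i`!%:R * (\sum_(k < n) x ^+ k / k`!%:R) =
    \sum_(j < n - i) f i j + \sum_(n - i <= j < n) f i j.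
  rewrite big_distrr -(big_mkord xpredT (f i)) -(big_mkord xpredT (f i)).
  by rewrite -big_cat_nat // leq_subr.
under eq_bigr do rewrite E.
rewrite big_split /= sum_antidiagonal; congr (_ + _).
apply: eq_bigr => m _; rewrite exprDn mulr_suml; apply: eq_bigr => i _.
have im : (i <= m)%N by rewrite -ltnS.
have mf : (m`!)%:R != 0 :> K by rewrite pnatr_eq0 -lt0n fact_gt0.
have if_ : (i`!)%:R != 0 :> K by rewrite pnatr_eq0 -lt0n fact_gt0.
have mif : ((m - i)`!)%:R != 0 :> K by rewrite pnatr_eq0 -lt0n fact_gt0.
rewrite /f -[_ *+ 'C(_, _)]mulr_natr.
have -> : ('C(m, i)%:R : K) = m`!%:R / (i`!%:R * (m - i)`!%:R).
  by rewrite -natrM -(bin_fact im) natrM mulfK // natrM mulf_neq0.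
by field; rewrite mf if_ mif.
Qed.

Lemma texp0 (K : numFieldType) (n : nat) : texp n.+1 (0 : K) = 1.
Proof.
rewrite /texp big_ord_recl expr0 fact0 divr1 big1 ?addr0 // => i _.
by rewrite /= exprS mul0r mul0r.
Qed.

Context {R : realType}.
Local Open Scope complex_scope.

Lemma texp_series (n : nat) (x : R) : texp n x = series (exp_coeff x) n.
Proof. by rewrite /texp /series /= big_mkord. Qed.

Lemma texp_cvg (x : R) : (fun n => texp n x) @ \oo --> expR x.
Proof.
have -> : (fun n => texp n x) = series (exp_coeff x).
  by apply/funext => n; exact: texp_series.
exact: is_cvg_series_exp_coeff.
Qed.

Lemma texp_le_expR (n : nat) (x : R) : 0 <= x -> texp n x <= expR x.
Proof.
move=> x0; rewrite texp_series.
apply: (nondecreasing_cvgn_le (u_ := series (exp_coeff x))).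
  by apply: nondecreasing_series => k _ _; exact: exp_coeff_ge0.
exact: is_cvg_series_exp_coeff.
Qed.

Lemma modc_texp (n : nat) (z : R[i]) : modc (texp n z) <= texp n (modc z).
Proof.
rewrite (le_trans (modc_sum _ _ _)) //; apply: ler_sum => k _.
by rewrite modcM modcX modcV natC modc_real ger0_norm.
Qed.

(** [texp n.+1 w * texp n.+1 (- w)] has no terms of degree between 1 and [n]; its
    terms of higher degree are dominated by those of [texp n.+1 (modc w) ^ 2]. *)
Lemma modc_texp_lower (n : nat) (w : R[i]) :
  1 - (texp n.+1 (modc w) ^+ 2 - texp n.+1 (modc w + modc w)) <=
  modc (texp n.+1 w) * expR (modc w).
Proof.
have w0 := modc_ge0 w.
apply: (@le_trans _ _ (modc (texp n.+1 w * texp n.+1 (- w)))).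
  rewrite expr2 !texpM subrr texp0.
  have aux (a b c : R) : 1 <= a + b -> 1 - (c + b - c) <= a by lra.
  apply: aux; rewrite -[X in X <= _](@modc1 R).
  set r := (X in 1 + X).
  apply: (@le_trans _ _ (modc (1 + r) + modc r)).
    by rewrite -lerBlDr -{1}(modcN r) lerBlDr -[X in modc X <= _](addrK r) modcD.
  rewrite lerD2l /r (le_trans (modc_sum _ _ _)) //; apply: ler_sum => i _.
  rewrite (le_trans (modc_sum _ _ _)) //; apply: ler_sum => j _.
  by rewrite !modcM !modcX !modcV !natC !modc_real modcN !ger0_norm.
rewrite modcM ler_wpM2l ?modc_ge0 // (le_trans (modc_texp _ _)) // modcN.
exact: texp_le_expR.
Qed.

End truncated_exponential.

(** * The characteristic function of the model *)

Lemma measurable_fun_randind (R : realType) d (T : measurableType d)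
    (N : T -> nat) (F : nat -> T -> R) :
  measurable_fun setT N -> (forall k, measurable_fun setT (F k)) ->
  measurable_fun setT (fun w => F (N w) w).
Proof.
move=> mN mF _ A mA; rewrite setTI.
have -> : (fun w => F (N w) w) @^-1` A =
    \bigcup_k (N @^-1` [set k] `&` F k @^-1` A).
  apply/seteqP; split => w /=; first by move=> h; exists (N w).
  by move=> [k _ [/= -> ]].
apply: bigcupT_measurable => k; apply: measurableI; rewrite -[X in measurable X]setTI.
- exact: mN.
- exact: mF.
Qed.

Lemma char_funE (R : realType) d (T : measurableType d) (P : probability T R)
    (X : T -> R) (t : R) :
  char_fun P X t = cexpect P (fun w => cis (t * X w)).
Proof. by congr cexpect; apply/funext => w; exact: cexp_itx. Qed.

Lemma normal_char_fun (R : realType) d (T : measurableType d)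
    (P : probability T R) (Z : T -> R) (t : R) :
  measurable_fun setT Z ->
  (forall A : set R, measurable A -> P (Z @^-1` A) = normal_prob 0 1 A) ->
  \int[P]_x cos (t * Z x) = expR (- (t ^+ 2 / 2)).
Proof.
move=> mZ lZ; rewrite -gauss_cos; apply/eqP; rewrite -subr_eq0; apply/eqP.
pose L (g : R -> R) := \int[P]_x g (Z x) - \int[lebesgue_measure]_x (g x * std_pdf x).
have bc (f : R -> R) : bmeas f -> bmeas (fun x => f (Z x)) by exact: bmeas_comp.
apply: (@bounded_functional_eq0 _ _ _ L 2 _ _ _ (fun x => cos (t * x))).
- move=> a f g bf bg; rewrite /L bmeas_intlin; [|exact: bc..].
  have i1 := bmeas_integrable_std_pdf (bmeasZ a bf).
  have -> : \int[lebesgue_measure]_x ((a * f x + g x) * std_pdf x) =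
      \int[lebesgue_measure]_x (a * f x * std_pdf x + g x * std_pdf x).
    by apply: eq_Rintegral => x _; rewrite mulrDl.
  rewrite RintegralD //; last exact: bmeas_integrable_std_pdf.
  have -> : \int[lebesgue_measure]_x (a * f x * std_pdf x) =
      \int[lebesgue_measure]_x (a * (f x * std_pdf x)).
    by apply: eq_Rintegral => x _; rewrite mulrA.
  by rewrite RintegralZl //; [ring|exact: bmeas_integrable_std_pdf].
- move=> f M bf fM; rewrite /L (le_trans (ler_normB _ _)) // mulr_natl mulr2n.
  apply: lerD; first by apply: norm_bmeas_int => //; exact: bc.
  apply: le_trans (le_normr_Rintegral _ (bmeas_integrable_std_pdf bf)) _ => //.
  have -> : M = \int[lebesgue_measure]_x (M * std_pdf x).
    by rewrite RintegralZl ?integrable_std_pdf // /Rintegral integral_normal_pdf mulr1.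
  apply: le_Rintegral => //.
  + exact: (integrable_norm (bmeas_integrable_std_pdf bf)).
  + exact: (bmeas_integrable_std_pdf (bmeas_cst _ M)).
  + by move=> x _; rewrite normrM (ger0_norm (std_pdf_ge0 x)) ler_wpM2r // std_pdf_ge0.
- move=> A mA; apply/eqP; rewrite /L subr_eq0; apply/eqP.
  have mZA : measurable (Z @^-1` A) by rewrite -[X in measurable X]setTI; exact: mZ.
  rewrite -[LHS]/(\int[P]_x \1_(Z @^-1` A) x) int_indic // lZ //.
  rewrite /normal_prob /Rintegral [X in fine X = _]integral_mkcond; congr fine.
  apply: eq_integral => x _; rewrite patchE indicE.
  by case: (x \in A); rewrite ?mul1r ?mul0r.
- by apply: bmeas_cos; exact: measurable_funM.
Qed.

Section compound_poisson.
Context (R : realType) (lam : R) (f : R -> R)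
  d (T : measurableType d) (P : probability T R)
  (N : {RV P >-> nat}) (W : nat -> {RV P >-> R}) (Z : {RV P >-> R}).
Hypothesis model : gauss_compound_poisson_model lam f N W Z.
Local Open Scope complex_scope.

Let X := gauss_compound_sum N (fun j => W j) Z.
Let S k w := \sum_(j < k) W j w.

Let mW j : measurable_fun setT (W j). Proof. exact: measurable_funP. Qed.
Let mZ : measurable_fun setT Z. Proof. exact: measurable_funP. Qed.
Let mS k : measurable_fun setT (S k).
Proof. by apply: measurable_sum => j; exact: mW. Qed.

Lemma measurable_gauss_compound_sum : measurable_fun setT X.
Proof.
apply: measurable_funD => //.
by apply: (measurable_fun_randind (F := S)); [exact: measurable_funP|exact: mS].
Qed.

Let phif t := cexpect P (fun w => cis (t * W 0%N w)).

Let cbt (t : R) : cbmeas (fun y : R => cis (t * y)).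
Proof. by apply: cbmeas_cis; exact: measurable_funM. Qed.

Let char_sum t k : cexpect P (fun w => cis (t * S k w)) = phif t ^+ k.
Proof.
have [_ [indW dW] _ _] := model.
have -> : (fun w => cis (t * S k w)) = (fun w => \prod_(j <- iota 0 k) cis (t * W j w)).
  by apply/funext => w; rewrite /S mulr_sumr cis_sum big_iota0.
rewrite (@indep_cexpect_prod _ _ _ P _ _ (fun j => W j) indW mW _
  (fun=> (fun y => cis (t * y)))) ?iota_uniq //; last first.
  by move=> j A mA; exists A => //; rewrite setTI.
rewrite big_iota0 -[in RHS](card_ord k) -prodr_const; apply: eq_bigr => j _.
rewrite /phif !cexpectE.
have law A : measurable A -> P (W j @^-1` A) = P (W 0%N @^-1` A).
  move=> mA; rewrite -[LHS]/(distribution P (W j) A).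
  by rewrite -[RHS]/(distribution P (W 0%N) A) !dW.
have [b1 b2] := cbt t.
congr (_ +i* _).
- exact: (same_law_int (mW j) (mW 0%N) b1 law).
- exact: (same_law_int (mW j) (mW 0%N) b2 law).
Qed.

Let mNk k : measurable (N @^-1` [set k]).
Proof. by rewrite -[X in measurable X]setTI; exact: measurable_funP. Qed.

Let char_term t k :
  cexpect P (fun w => (\1_(N @^-1` [set k]) w)%:C * (cis (t * S k w) * cis (t * Z w))) =
  (poisson_pmf lam k)%:C * (phif t ^+ k * cexpect P (fun w => cis (t * Z w))).
Proof.
have [pN _ _ indF] := model.
pose V (i : 'I_3) : T -> R :=
  nth (fun=> 0) [:: fun w => (N w)%:R; S k; fun w => Z w] i.
pose g (i : 'I_3) : R -> R[i] :=
  nth (fun=> 0) [:: fun y => (\1_[set k%:R] y)%:C; fun y => cis (t * y);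
                    fun y => cis (t * y)] i.
have mV i : measurable_fun setT (V i).
  case: i => [[|[|[|//]]]] i3 //=; rewrite /V /=.
  - move=> _ B mB.
    exact: (measurable_funP N measurableT ((fun n : nat => n%:R : R) @^-1` B) I).
  - exact: mS.
have bg i : cbmeas (g i).
  case: i => [[|[|[|//]]]] i3 //=; rewrite /g /=.
  - by apply: cbmeas_real; exact: bmeas_indic.
  - exact: cbt.
  - exact: cbt.
have VF (i : 'I_3) (A : set R) : measurable A ->
    nth set0 [:: g_sigma_algebra_preimage N;
                     <<s \bigcup_j g_sigma_algebra_preimage (W j) >>;
                     g_sigma_algebra_preimage Z] i (V i @^-1` A).
  case: i => [[|[|[|//]]]] i3 mA; rewrite /V /=.
  - by exists ((fun n : nat => n%:R) @^-1` A) => //; rewrite setTI.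
  - pose G := \bigcup_j g_sigma_algebra_preimage (W j).
    have mG j : measurable_fun setT (W j : g_sigma_algebraType G -> R).
      move=> _ B mB; apply: sub_sigma_algebra; exists j => //.
      by exists B.
    have := measurable_sum (index_enum 'I_k) (fun j : 'I_k => mG j) measurableT mA.
    by rewrite setTI.
  - by exists A => //; rewrite setTI.
have := indep_cexpect_prod indF mV VF bg (index_enum_uniq _).
have -> : (fun w => \prod_(i : 'I_3) g i (V i w)) =
   (fun w => (\1_(N @^-1` [set k]) w)%:C * (cis (t * S k w) * cis (t * Z w))).
  apply/funext => w; rewrite !big_ord_recl big_ord0 /g /V /= mulr1.
  congr (_%:C * _); rewrite !indicE; congr (nat_of_bool _)%:R.
  by apply/idP/idP; rewrite !inE /= => /eqP; rewrite ?eqr_nat => /eqP ->.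
move=> ->; rewrite !big_ord_recl big_ord0 /g /V /= mulr1.
rewrite -char_sum; congr (_ * _).
have -> : (fun w => (\1_[set k%:R] ((N w)%:R : R))%:C) =
    (fun w => (\1_(N @^-1` [set k]) w : R)%:C).
  apply/funext => w; congr _%:C; rewrite !indicE; congr (nat_of_bool _)%:R.
  by apply/idP/idP; rewrite !inE /= => /eqP; rewrite ?eqr_nat => /eqP ->.
by rewrite cexpect_real int_indic // pN.
Qed.

Let int_Nk k : \int[P]_w \1_(N @^-1` [set k]) w = poisson_pmf lam k.
Proof. by rewrite int_indic //; have [-> _ _ _] := model. Qed.

Let modc_phif t : modc (phif t) <= 1.
Proof.
rewrite -(prob_cst P 1); apply: modc_cexpect; last by move=> w; rewrite modc_cis.
- by apply: cbmeas_cis; apply: measurable_funM.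
- exact/bmeas_integrable/bmeas_cst.
Qed.

Let modc_normal t : expR (- (t ^+ 2 / 2)) <= modc (cexpect P (fun w => cis (t * Z w))).
Proof.
have [_ _ lZ _] := model.
rewrite -(normal_char_fun t mZ lZ) (le_trans _ (Re_le_modc _)) //.
by rewrite cexpectE /= ler_norm.
Qed.

Let indN k (w : T) : \1_(N @^-1` [set k]) w = (N w == k)%:R :> R.
Proof.
rewrite indicE; congr (nat_of_bool _)%:R; apply/idP/eqP.
- by rewrite inE.
- by move=> Nk; rewrite inE.
Qed.

(** Summing over the values [k < n] of [N] gives a partial sum of the exponential
    series at [lam * phif t]; the error is at most [P (n <= N)]. *)
Let char_fun_trunc t n : 0 < lam ->
  modc (char_fun P X t - (expR (- lam))%:C * texp n (lam%:C * phif t) *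
    cexpect P (fun w => cis (t * Z w))) <= 1 - expR (- lam) * texp n lam.
Proof.
move=> lam0; pose a k w :=
  (\1_(N @^-1` [set k]) w)%:C * (cis (t * S k w) * cis (t * Z w)).
have pmfE k : poisson_pmf lam k = expR (- lam) * (lam ^+ k / k`!%:R).
  by rewrite /poisson_pmf lam0; ring.
have ba k : cbmeas (a k).
  apply: cbmeasM; first by apply: cbmeas_real; exact: bmeas_indic.
  by apply: cbmeasM; apply: cbmeas_cis; exact: measurable_funM.
have bX : cbmeas (fun w => cis (t * X w)).
  by apply: cbmeas_cis; apply: measurable_funM => //; exact: measurable_gauss_compound_sum.
pose b w := 1 - \sum_(k < n) \1_(N @^-1` [set (k : nat)]) w : R.
have bsum : bmeas (fun w => \sum_(k < n) \1_(N @^-1` [set (k : nat)]) w : R).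
  by apply: bmeas_sum => k; exact: bmeas_indic.
have -> : 1 - expR (- lam) * texp n lam = \int[P]_w b w.
  rewrite bmeas_intB //; last exact: bmeas_cst.
  rewrite prob_cst; congr (_ - _).
  have : forall m, \int[P]_w (\sum_(k < m) \1_(N @^-1` [set (k : nat)]) w : R) =
      \sum_(k < m) poisson_pmf lam k.
    elim=> [|m IH].
      by under eq_Rintegral do rewrite big_ord0; rewrite prob_cst big_ord0.
    under eq_Rintegral do rewrite big_ord_recr.
    rewrite bmeas_intD; last exact: bmeas_indic.
      by rewrite IH int_Nk [RHS]big_ord_recr.
    by apply: bmeas_sum => k; exact: bmeas_indic.
  by move=> ->; rewrite /texp mulr_sumr; apply: eq_bigr => k _; rewrite pmfE.
have -> : (expR (- lam))%:C * texp n (lam%:C * phif t) *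
    cexpect P (fun w => cis (t * Z w)) =
    cexpect P (fun w => \sum_(k < n) a k w).
  rewrite (@cexpect_sum _ _ R P _ _ (fun (k : 'I_n) => a k)) //.
  rewrite /texp mulr_sumr mulr_suml; apply: eq_bigr => k _.
  rewrite /a char_term pmfE exprMn natC invC !rmorphM rmorphXn /=; ring.
have bS : cbmeas (fun w => \sum_(k < n) a k w).
  exact: (@cbmeas_sum _ T R _ _ (fun (k : 'I_n) => a k)).
rewrite char_funE -cexpectB //; apply: modc_cexpect; first exact: cbmeasB.
  by apply: bmeas_integrable; apply: bmeasB => //; exact: bmeas_cst.
move=> w; have [Nn|nN] := ltnP (N w) n.
- have E (V : nmodType) (F : nat -> V) : (forall k, k != N w -> F k = 0) ->
      \sum_(k < n) F k = F (N w).
    move=> F0; rewrite (bigD1 (Ordinal Nn)) //= big1 ?addr0 // => k kN.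
    by apply: F0.
  rewrite /b (E _ (fun k => \1_(N @^-1` [set k]) w)) ?indN ?eqxx ?subrr; last first.
    by move=> k; rewrite eq_sym indN => /negbTE ->.
  rewrite (E _ (fun k => a k w)); last first.
    by move=> k; rewrite eq_sym /a indN => /negbTE ->; rewrite mul0r.
  rewrite /a indN eqxx mul1r -cisD -mulrDr -/(X w) subrr modc0.
  by [].
- have N0 (k : 'I_n) : (N w == k) = false.
    by apply/negbTE; rewrite gtn_eqF // (leq_trans (ltn_ord k)).
  rewrite big1 => [|k _]; last by rewrite /a indN N0 mul0r.
  rewrite /b big1 => [|k _]; last by rewrite indN N0.
  by rewrite !subr0 modc_cis.
Qed.

(** The limit [n -> oo] of the truncation. *)
Lemma char_fun_lower t : 0 < lam ->
  expR (- lam) * expR (- lam) * expR (- (t ^+ 2 / 2)) <= modc (char_fun P X t).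
Proof.
move=> lam0; set q := expR (- (t ^+ 2 / 2)); set e := expR (- lam).
pose w := lam%:C * phif t.
have wlam : modc w <= lam.
  by rewrite modcM modc_real gtr0_norm // ler_piMr // ltW.
pose rem n := texp n (modc w) ^+ 2 - texp n (modc w + modc w).
have bound n : e * e * (1 - rem n.+1) * q <= modc (char_fun P X t) +
    (1 - e * texp n.+1 lam).
  have H1 := modc_texp_lower n w; have H2 := char_fun_trunc t n.+1 lam0.
  have H3 := modc_normal t; rewrite -/q in H3.
  rewrite -lerBlDl; apply: le_trans H2; rewrite -/w -/e.
  rewrite modc_distC; apply: le_trans (modcB _ _); rewrite lerD2r.
  rewrite !modcM modc_real ger0_norm ?expR_ge0 //.
  have q0 : 0 <= q := expR_ge0 _.
  rewrite -mulrA -[leRHS]mulrA -[leLHS]mulrA ler_wpM2l ?expR_ge0 // mulrA.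
  have H4 : e * (1 - rem n.+1) <= modc (texp n.+1 w).
    rewrite -(ler_pM2l (expR_gt0 lam)) mulrA -expRD subrr expR0 mul1r.
    rewrite (le_trans H1) // mulrC ler_wpM2r ?modc_ge0 // ler_expR //.
  apply: (@le_trans _ _ (modc (texp n.+1 w) * q)); first by rewrite ler_wpM2r.
  by rewrite ler_wpM2l ?modc_ge0.
have cS (x : R) : (fun n => texp n.+1 x) @ \oo --> expR x.
  by have := @texp_cvg R x; rewrite -cvg_shiftS.
have crem : (fun n => rem n.+1) @ \oo --> (0 : R).
  rewrite /rem -[X in _ --> X](subrr (expR (modc w + modc w))).
  apply: cvgB; last exact: cS.
  by rewrite expRD; under eq_fun do rewrite expr2; apply: cvgM; exact: cS.
have cl : (fun n => e * e * (1 - rem n.+1) * q) @ \oo --> e * e * q.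
  rewrite -[X in _ --> X * q]mulr1 -[X in _ --> _ * X * q]subr0.
  apply: cvgM; last exact: cvg_cst.
  by apply: cvgM; [exact: cvg_cst|apply: cvgB; [exact: cvg_cst|exact: crem]].
have cr : (fun n => modc (char_fun P X t) + (1 - e * texp n.+1 lam)) @ \oo -->
    modc (char_fun P X t).
  rewrite -[X in _ --> X]addr0; apply: cvgD; first exact: cvg_cst.
  rewrite -[X in _ --> X](subrr (1 : R)); apply: cvgB; first exact: cvg_cst.
  rewrite -[X in _ --> X]expR0 -(addNr lam) expRD.
  by apply: cvgM; [exact: cvg_cst|exact: cS].
by apply: (ler_cvg_to cl cr); apply: nearW => n; exact: bound.
Qed.

End compound_poisson.

(** * The distinguished logarithm *)

Section complex_topology.
Context {R : realType}.
Local Open Scope complex_scope.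

Lemma normC_modc (z : R[i]^o) : `|z| = (modc z)%:C.
Proof. by rewrite normc_def modcE. Qed.

Lemma cvg_complexP (T : Type) (F : set_system T) (FF : Filter F)
    (f : T -> R[i]^o) (z : R[i]^o) :
  f x @[x --> F] --> z <->
  (complex.Re (f x) @[x --> F] --> complex.Re z) /\
  (complex.Im (f x) @[x --> F] --> complex.Im z).
Proof.
split=> [/cvgrPdist_lt fz|[fr fi]].
  have H (e : R) : 0 < e -> \forall x \near F, modc (z - f x) < e.
    move=> e0; have := fz e%:C; rewrite ltcR => /(_ e0).
    by apply: filterS => x; rewrite normC_modc ltcR.
  split; apply/cvgrPdist_lt => e /H; apply: filterS => x; apply: le_lt_trans.
  - by rewrite (le_trans _ (Re_le_modc _)) // cReD cReN.
  - by rewrite (le_trans _ (Im_le_modc _)) // cImD cImN.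
apply/cvgrPdist_lt => -[e e']; rewrite ltcE /= => /andP[/eqP -> e0].
have e2 : 0 < e / 2 by rewrite divr_gt0.
near=> x; rewrite normC_modc ltcR (le_lt_trans (modc_le_ReIm _)) //.
rewrite cReD cReN cImD cImN (splitr e) ltrD //; near: x.
- exact: cvgr_dist_lt.
- exact: cvgr_dist_lt.
Unshelve. all: by end_near. Qed.

Lemma lipschitz_continuous (f : R -> R) (K : R) :
  (forall s t, `|f t - f s| <= K * `|t - s|) -> continuous f.
Proof.
move=> fK t; apply/cvgrPdist_lt => e e0.
have K1 : 0 < `|K| + 1 by rewrite ltr_pwDr.
near=> s; rewrite (le_lt_trans (fK _ _)) //.
have : `|t - s| < e / (`|K| + 1).
  by near: s; apply: cvgr_dist_lt; [exact: cvg_id|rewrite divr_gt0].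
rewrite ltr_pdivlMr //; apply: le_lt_trans.
by rewrite mulrC ler_wpM2l // (le_trans (ler_norm _)) // lerDl.
Unshelve. all: by end_near. Qed.

(** The principal logarithm, by a formula that is only correct in the open right
    half-plane. *)
Definition clog (z : R[i]) : R[i] :=
  ln (modc z) +i* atan (complex.Im z / complex.Re z).

Lemma cexp_clog (z : R[i]) : 0 < complex.Re z -> cexp (clog z) = z.
Proof.
move=> a0; have m0 : 0 < modc z.
  by rewrite (lt_le_trans a0) // (le_trans (ler_norm _)) // Re_le_modc.
set a := complex.Re z; set b := complex.Im z; rewrite -/a in a0.
have ca : cos (atan (b / a)) = a / modc z.
  rewrite cos_atan modcE -/a -/b.
  have -> : 1 + (b / a) ^+ 2 = (a ^+ 2 + b ^+ 2) / a ^+ 2 by field; rewrite gt_eqF.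
  by rewrite sqrtrM ?addr_ge0 ?sqr_ge0 // sqrtrV ?sqr_ge0 // sqrtr_sqr gtr0_norm // invf_div.
have sa : sin (atan (b / a)) = b / modc z.
  have := atanK (b / a); rewrite /tan ca => /(canRL (mulfVK _)) ->.
    by field; rewrite !gt_eqF.
  by rewrite mulf_neq0 ?invr_neq0 ?gt_eqF.
rewrite cexpE -[complex.Re (clog z)]/(ln (modc z)) lnK ?posrE //.
rewrite -[complex.Im (clog z)]/(atan (b / a)).
by apply: complexP; rewrite ?cReZ ?cImZ /= ?ca ?sa mulrC divfK // gt_eqF.
Qed.

Lemma continuous_clog_comp (u : R -> R[i]) (t : R) :
  {for t, continuous (fun s => complex.Re (u s))} ->
  {for t, continuous (fun s => complex.Im (u s))} ->
  0 < complex.Re (u t) ->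
  {for t, continuous (fun s => complex.Re (clog (u s)))} /\
  {for t, continuous (fun s => complex.Im (clog (u s)))}.
Proof.
move=> cr ci a0; split.
- have m0 : 0 < modc (u t).
    by rewrite (lt_le_trans a0) // (le_trans (ler_norm _)) // Re_le_modc.
  apply: (@continuous_comp _ _ _ (fun s => modc (u s)) (@ln R)); last exact: continuous_ln.
  have -> : (fun s => modc (u s)) =
      Num.sqrt \o (fun s => complex.Re (u s) * complex.Re (u s) +
                            complex.Im (u s) * complex.Im (u s)).
    by apply/funext => s; rewrite modcE !expr2.
  apply: continuous_comp; last exact: sqrt_continuous.
  by apply: cvgD; apply: cvgM.
- apply: (@continuous_comp _ _ _ (fun s => complex.Im (u s) / complex.Re (u s)) (@atan R)).
    by apply: cvgM => //; apply: cvgV => //; rewrite gt_eqF.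
  exact: continuous_atan.
Qed.

Lemma continuous_div (u v : R -> R[i]) (t : R) :
  {for t, continuous (fun s => complex.Re (u s))} ->
  {for t, continuous (fun s => complex.Im (u s))} ->
  {for t, continuous (fun s => complex.Re (v s))} ->
  {for t, continuous (fun s => complex.Im (v s))} -> v t != 0 ->
  {for t, continuous (fun s => complex.Re (u s / v s))} /\
  {for t, continuous (fun s => complex.Im (u s / v s))}.
Proof.
move=> ur ui vr vi vt0.
pose N s := complex.Re (v s) * complex.Re (v s) + complex.Im (v s) * complex.Im (v s).
have cN : {for t, continuous N} by apply: cvgD; apply: cvgM.
have Nt0 : N t != 0.
  by rewrite /N -!expr2 -sqr_modc sqrf_eq0 modc_eq0.
have cNV : {for t, continuous (fun s => (N s)^-1)} by apply: cvgV.
have nvi : {for t, continuous (fun s => - complex.Im (v s))} by exact: cvgN.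
have vr' : {for t, continuous (fun s => complex.Re (v s) * (N s)^-1)} by exact: cvgM.
have vi' : {for t, continuous (fun s => - complex.Im (v s) * (N s)^-1)} by exact: cvgM.
have vE s : (v s)^-1 = (complex.Re (v s) * (N s)^-1) +i* (- complex.Im (v s) * (N s)^-1).
  by rewrite /N -!expr2; case: (v s) => a b /=; rewrite mulNr.
split.
- have -> : (fun s => complex.Re (u s / v s)) = (fun s =>
    complex.Re (u s) * (complex.Re (v s) * (N s)^-1) -
    complex.Im (u s) * (- complex.Im (v s) * (N s)^-1)).
    by apply/funext => s; rewrite cReM vE.
  apply: (@continuousB _ _ _ (fun s => complex.Re (u s) * (complex.Re (v s) * (N s)^-1))
    (fun s => complex.Im (u s) * (- complex.Im (v s) * (N s)^-1))).
  + exact: cvgM.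
  + exact: cvgM.
- have -> : (fun s => complex.Im (u s / v s)) = (fun s =>
    complex.Re (u s) * (- complex.Im (v s) * (N s)^-1) +
    complex.Im (u s) * (complex.Re (v s) * (N s)^-1)).
    by apply/funext => s; rewrite cImM vE.
  apply: (@continuousD _ _ _ (fun s => complex.Re (u s) * (- complex.Im (v s) * (N s)^-1))
    (fun s => complex.Im (u s) * (complex.Re (v s) * (N s)^-1))).
  + exact: cvgM.
  + exact: cvgM.
Qed.

Lemma continuous_for_sum (n : nat) (F : nat -> R -> R) (t : R) :
  (forall k, (k < n)%N -> {for t, continuous (F k)}) ->
  {for t, continuous (fun s => \sum_(k < n) F k s)}.
Proof.
elim: n => [|n IH] cF.
  have -> : (fun s => \sum_(k < 0) F k s) = (fun=> 0).
    by apply/funext => s; rewrite big_ord0.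
  exact: cvg_cst.
have -> : (fun s => \sum_(k < n.+1) F k s) = (fun s => \sum_(k < n) F k s + F n s).
  by apply/funext => s; rewrite big_ord_recr.
apply: (@continuousD _ _ _ (fun s => \sum_(k < n) F k s) (F n)); last exact: cF.
by apply: IH => k kn; apply: cF; rewrite ltnW.
Qed.

Lemma prod_telescope (n : nat) (F : nat -> R[i]) : (forall k, (k < n)%N -> F k != 0) ->
  F 0%N != 0 -> \prod_(k < n) (F k.+1 / F k) = F n / F 0%N.
Proof.
move=> + F00; elim: n => [_|n IH F0]; first by rewrite big_ord0 divff.
rewrite big_ord_recr /= IH => [|k kn]; last by rewrite F0 // ltnW.
by rewrite mulrC mulrA divfK // F0.
Qed.

(** Cut the segment from 0 to [t] into [n] equal pieces: for [n] large, uniformly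
    in [t], the ratio of the values of [g] at the ends of each piece lies in the
    right half-plane, where the principal logarithm is continuous. The sum of
    the principal logarithms of the ratios is the lift. *)
Lemma log_lift_exists (g : R -> R[i]) (K r : R) : 0 < r ->
  (forall s t, modc (g t - g s) <= K * `|t - s|) ->
  (forall t, t \in `[- r, r] -> g t != 0) -> g 0 = 1 ->
  exists L : R -> R[i],
    [/\ forall t, t \in `[- r, r] -> {for t, continuous (fun s => complex.Re (L s))} /\
          {for t, continuous (fun s => complex.Im (L s))},
        forall t, t \in `[- r, r] -> cexp (L t) = g t
      & L 0 = 0].
Proof.
move=> r0 gK gn0 g0.
have crg : continuous (fun t => complex.Re (g t)).
  apply: (@lipschitz_continuous _ K) => s t; apply: le_trans (gK s t).
  by rewrite (le_trans _ (Re_le_modc _)) // cReD cReN.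
have cig : continuous (fun t => complex.Im (g t)).
  apply: (@lipschitz_continuous _ K) => s t; apply: le_trans (gK s t).
  by rewrite (le_trans _ (Im_le_modc _)) // cImD cImN.
have cmg : continuous (fun t => modc (g t)).
  apply: (@lipschitz_continuous _ K) => s t; apply: le_trans (gK s t).
  exact: modc_dist.
have rr : - r <= r by rewrite -subr_ge0 opprK addr_ge0 // ltW.
have [c cr gc] := @EVT_min R _ (- r) r rr (continuous_subspaceT cmg).
set m := modc (g c) in gc.
have m0 : 0 < m by rewrite modc_gt0 gn0.
pose n := (Num.truncn (`|K| * r / m)).+1.
have n0 : 0 < n%:R :> R by rewrite ltr0n.
have nK : `|K| * r < m * n%:R.
  by rewrite [ltRHS]mulrC -ltr_pdivrMr // truncnS_gt.
pose p (k : nat) (t : R) := k%:R / n%:R * t.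
have pin k t : (k <= n)%N -> t \in `[- r, r] -> p k t \in `[- r, r].
  move=> kn; rewrite !in_itv /= -!ler_norml; apply: le_trans.
  rewrite /p normrM ler_piMl // ger0_norm ?divr_ge0 //.
  by rewrite ler_pdivrMr // mul1r ler_nat.
pose rho (k : nat) (t : R) := g (p k.+1 t) / g (p k t).
have rho_Re k t : (k < n)%N -> t \in `[- r, r] -> 0 < complex.Re (rho k t).
  move=> kn tr.
  have gk0 : g (p k t) != 0 by apply: gn0; apply: pin => //; exact: ltnW.
  suff : modc (rho k t - 1) < 1.
    move=> /(le_lt_trans (Re_le_modc _)); rewrite cReD cReN /= ltr_norml.
    by move=> /andP[h _]; move: h; rewrite ltrBrDr addrC subrr.
  have -> : rho k t - 1 = (g (p k.+1 t) - g (p k t)) / g (p k t).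
    by rewrite mulrBl divff.
  rewrite modcM modcV ltr_pdivrMr ?modc_gt0 // mul1r.
  have mg : m <= modc (g (p k t)) by apply: gc; apply: pin => //; exact: ltnW.
  apply: (lt_le_trans _ mg); apply: (le_lt_trans (gK _ _)).
  have -> : p k.+1 t - p k t = n%:R^-1 * t.
    by rewrite /p -mulrBl -mulrBl -natr1 addrAC subrr add0r mul1r.
  rewrite normrM ger0_norm ?invr_ge0 // mulrCA ltr_pdivrMl // [ltRHS]mulrC.
  apply: (le_lt_trans _ nK); apply: (@le_trans _ _ (`|K| * `|t|)).
    by rewrite ler_wpM2r // ler_norm.
  by rewrite ler_wpM2l //; move: tr; rewrite in_itv /= -ler_norml.
exists (fun t => \sum_(k < n) clog (rho k t)); split.
- move=> t tr.
  have cp k : continuous (p k) by move=> s; apply: cvgMl_tmp; exact: cvg_id.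
  have crho k : (k < n)%N -> {for t, continuous (fun s => complex.Re (rho k s))} /\
      {for t, continuous (fun s => complex.Im (rho k s))}.
    move=> kn; apply: continuous_div; last by apply: gn0; apply: pin => //; exact: ltnW.
    + by apply: (@continuous_comp _ _ _ (p k.+1) (fun s => complex.Re (g s)));
        [exact: cp|exact: crg].
    + by apply: (@continuous_comp _ _ _ (p k.+1) (fun s => complex.Im (g s)));
        [exact: cp|exact: cig].
    + by apply: (@continuous_comp _ _ _ (p k) (fun s => complex.Re (g s)));
        [exact: cp|exact: crg].
    + by apply: (@continuous_comp _ _ _ (p k) (fun s => complex.Im (g s)));
        [exact: cp|exact: cig].
  split.
  + have -> : (fun s => complex.Re (\sum_(k < n) clog (rho k s))) =
        (fun s => \sum_(k < n) complex.Re (clog (rho k s))).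
      by apply/funext => s; exact: cRe_sum.
    apply: (@continuous_for_sum n (fun k s => complex.Re (clog (rho k s)))) => k kn.
    have [h1 h2] := crho k kn.
    by have [] := continuous_clog_comp h1 h2 (rho_Re k t kn tr).
  + have -> : (fun s => complex.Im (\sum_(k < n) clog (rho k s))) =
        (fun s => \sum_(k < n) complex.Im (clog (rho k s))).
      by apply/funext => s; exact: cIm_sum.
    apply: (@continuous_for_sum n (fun k s => complex.Im (clog (rho k s)))) => k kn.
    have [h1 h2] := crho k kn.
    by have [] := continuous_clog_comp h1 h2 (rho_Re k t kn tr).
- move=> t tr; rewrite cexp_sum.
  have -> : \prod_(k < n) cexp (clog (rho k t)) = \prod_(k < n) rho k t.
    by apply: eq_bigr => k _; rewrite cexp_clog // rho_Re.
  rewrite (@prod_telescope n (fun k => g (p k t))).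
  + by rewrite /p mul0r mul0r g0 divr1 divff ?gt_eqF // mul1r.
  + by move=> k kn; apply: gn0; apply: pin => //; exact: ltnW.
  + by rewrite /p mul0r mul0r g0 oner_neq0.
- rewrite big1 // => k _; rewrite /rho /p !mulr0 g0 divr1 /clog modc1 ln1.
  by rewrite /= mul0r atan0.
Qed.

(** Otherwise, by the intermediate value theorem, [d] would take a value in
    (0, pi], where the cosine is less than 1. *)
Lemma cos_lift_le0 (d : R -> R) (a b : R) : a <= b ->
  {within `[a, b], continuous d} -> (forall s, s \in `[a, b] -> cos (d s) = 1) ->
  Num.min (d a) (d b) <= 0 -> Num.max (d a) (d b) <= 0.
Proof.
move=> ab cd d1 dmin; rewrite leNgt; apply/negP => dmax.
pose v := Num.min (Num.max (d a) (d b)) pi.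
have v0 : 0 < v by rewrite lt_min dmax pi_gt0.
have [|c ct dc] := @IVT R d a b v ab cd.
  by rewrite (le_trans dmin (ltW v0)) /= ge_min lexx.
have := d1 c ct; rewrite dc => cv1.
have : cos v < cos 0.
  by rewrite ltr_cos // in_itv /= ?lexx ?pi_ge0 // (ltW v0) /= ge_min lexx orbT.
by rewrite cv1 cos0 ltxx.
Qed.

Lemma cos_lift_eq0 (d : R -> R) (r t : R) :
  {within `[- r, r], continuous d} -> (forall s, s \in `[- r, r] -> cos (d s) = 1) ->
  d 0 = 0 -> t \in `[- r, r] -> d t = 0.
Proof.
move=> cd d1 d0 tr.
have H (e : R -> R) : {within `[- r, r], continuous e} ->
    (forall s, s \in `[- r, r] -> cos (e s) = 1) -> e 0 = 0 -> e t <= 0.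
  move=> ce e1 e0; pose a := Num.min 0 t; pose b := Num.max 0 t.
  have r0 : 0 <= r by move: tr; rewrite in_itv /= -ler_norml; apply: le_trans.
  have sub : `[a, b] `<=` `[- r, r].
    move=> x /=; move: tr; rewrite !in_itv /= /a /b => /andP[t1 t2] /andP[x1 x2].
    rewrite (le_trans _ x1) ?(le_trans x2) // ?ge_max ?le_min ?oppr_le0 ?r0 //.
  have ab : a <= b by rewrite /a /b ge_min le_max lexx.
  have := @cos_lift_le0 e a b ab (continuous_subspaceW sub ce)
    (fun s sab => e1 s (sub s sab)).
  rewrite /a /b; have [t0|t0] := leP 0 t; rewrite e0.
  + rewrite ge_min lexx => /(_ isT); rewrite ge_max => /andP[//].
  + rewrite ge_min lexx orbT => /(_ isT); rewrite ge_max => /andP[//].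
apply/eqP; rewrite eq_le H //= -oppr_le0; apply: (H (fun s => - d s)).
- by move=> x; apply: cvgN; exact: cd.
- by move=> s sr; rewrite cosN d1.
- by rewrite d0 oppr0.
Qed.

End complex_topology.

Section empirical.
Context {R : realType}.
Implicit Types (x : nat -> R) (n : nat) (s t : R).

Lemma emp_char_funE x n t :
  emp_char_fun x n t = n%:R^-1 * \sum_(j < n) cis (t * x j).
Proof. by congr (_ * _); apply: eq_bigr => j _; exact: cexp_itx. Qed.

Lemma emp_char_fun0 x n : (0 < n)%N -> emp_char_fun x n 0 = 1.
Proof.
move=> n0; rewrite emp_char_funE.
under eq_bigr do rewrite mul0r cis0.
by rewrite sumr_const card_ord mulVf // pnatr_eq0 -lt0n.
Qed.

Lemma emp_char_fun_lipschitz x n s t :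
  modc (emp_char_fun x n t - emp_char_fun x n s) <=
  2 * (n%:R^-1 * \sum_(j < n) `|x j|) * `|t - s|.
Proof.
rewrite !emp_char_funE -mulrBr modcM modcV natC modc_real ger0_norm //.
rewrite -sumrB -!mulrA mulrCA ler_wpM2l ?invr_ge0 //.
rewrite (le_trans (modc_sum _ _ _)) // mulr_suml mulr_sumr.
apply: ler_sum => j _; rewrite (le_trans (cis_lipschitz _ _)) //.
by rewrite -mulrBl normrM (mulrC `|t - s|).
Qed.

Lemma dlog_argE lam h x n t : 0 < h -> t \in `[- h^-1, h^-1] ->
  dlog_arg lam h x n t = (expR (lam + t ^+ 2 / 2))%:C%C * emp_char_fun x n t.
Proof.
move=> h0 th; rewrite /dlog_arg.
have -> : sinc_ft (h * t) = 1.
  rewrite /sinc_ft indicE mem_set //= in_itv /= -ler_norml normrM gtr0_norm //.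
  by rewrite -ler_pdivlMl // mulr1 ler_norml; move: th; rewrite in_itv.
rewrite mulr1 -expRD -opprD expRN -invC invrK mulrC.
by congr (_ * _).
Qed.

(** The argument of the distinguished logarithm is, up to the positive factor
    [exp (lam + t ^ 2 / 2)], the Lipschitz curve [emp_char_fun], which starts at
    1; so nonvanishing is the only obstruction. *)
Lemma dlog_well_definedP lam h x n : 0 < h ->
  dlog_well_defined (dlog_arg lam h x n) lam h^-1 <->
  (0 < n)%N /\ forall t, t \in `[- h^-1, h^-1] -> emp_char_fun x n t != 0.
Proof.
move=> h0; have r0 : 0 < h^-1 by rewrite invr_gt0.
have zin : 0 \in `[- h^-1, h^-1] by rewrite in_itv /= oppr_le0 ltW.
have eN0 (u : R) : (expR u)%:C%C != 0 :> R[i].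
  by rewrite -modc_eq0 modc_real normr_eq0 gt_eqF // expR_gt0.
split=> [[g0 _]|[n0 g0]].
  split=> [|t th].
    rewrite lt0n; apply/negP => /eqP n0; have := g0 0 zin.
    by rewrite dlog_argE // n0 emp_char_funE big_ord0 !mulr0 eqxx.
  by have := g0 t th; rewrite dlog_argE // mulf_eq0 (negbTE (eN0 _)).
split=> [t th|]; first by rewrite dlog_argE // mulf_neq0 // g0.
have [L [cL eL L0]] := log_lift_exists r0 (emp_char_fun_lipschitz x n) g0
  (emp_char_fun0 x n0).
exists (fun t => (lam + t ^+ 2 / 2)%:C%C + L t).
set M := fun t => (lam + t ^+ 2 / 2)%:C%C + L t.
have dM : is_dlog (dlog_arg lam h x n) lam h^-1 M.
  split.
  - apply: continuous_in_subspaceT => t /set_mem tr; have [c1 c2] := cL t tr.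
    apply/cvg_complexP; split.
    + have -> : (fun s => complex.Re (M s)) =
          (fun s => (lam + s * s / 2) + complex.Re (L s)).
        by apply/funext => s; rewrite /M cReD /= expr2.
      rewrite cReD /= expr2; apply: cvgD => //; apply: cvgD; first exact: cvg_cst.
      by apply: cvgMr_tmp; apply: cvgM; exact: cvg_id.
    + have -> : (fun s => complex.Im (M s)) = (fun s => complex.Im (L s)).
        by apply/funext => s; rewrite /M cImD /= add0r.
      by rewrite cImD /= add0r.
  - by move=> t tr; rewrite cexpD cexp_real eL // dlog_argE.
  - by rewrite /M L0 expr0n mul0r !addr0.
split=> // L' [cL' eL' L'0] t tr; have [cM eM M0] := dM.
have reE s : s \in `[- h^-1, h^-1] -> complex.Re (L' s) = complex.Re (M s).
  move=> sr; apply: expR_inj.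
  have := congr1 (@modc R) (etrans (eL' s sr) (esym (eM s sr))).
  by rewrite !cexpE !modcM !modc_cis !mulr1 !modc_real !ger0_norm ?expR_ge0.
have cisE s : s \in `[- h^-1, h^-1] -> cis (complex.Im (L' s)) = cis (complex.Im (M s)).
  move=> sr; apply: (mulfI (eN0 (complex.Re (M s)))).
  by rewrite -{1}reE // -!cexpE eL' // eM.
apply: complexP; first exact: reE.
apply/eqP; rewrite -subr_eq0; apply/eqP.
apply: (@cos_lift_eq0 _ (fun s => complex.Im (L' s) - complex.Im (M s)) h^-1) => //.
- move=> s; apply: cvgB.
  + by have /cvg_complexP[] := cL' s.
  + by have /cvg_complexP[] := cM s.
- move=> s sr; have [c1 s1] := cisE s sr.
  by rewrite cosB c1 s1 -!expr2 cos2Dsin2.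
- by rewrite L'0 M0 subrr.
Qed.

End empirical.

(** * Measurability of the events *)

Lemma modc_emp_continuous (R : realType) (x : nat -> R) (n : nat) :
  continuous (fun t => modc (emp_char_fun x n t)).
Proof.
apply: lipschitz_continuous => s t.
apply: le_trans (emp_char_fun_lipschitz x n s t).
exact: modc_dist.
Qed.

(** The interval has nonempty interior, so even an endpoint is a limit of
    rational points of the interval. *)
Lemma rat_dense_lt (R : realType) (F : R -> R) (r c t : R) :
  0 < r -> continuous F -> t \in `[- r, r] -> F t < c ->
  exists2 q : rat, ratr q \in `[- r, r] & F (ratr q) < c.
Proof.
move=> r0 cF tr Ft.
have /nbhs_ballP[e /= e0 He] : \forall s \near t, F s < c.
  exact: (cvgr_lt _ (cF t)).
have [t1 t2] : - r <= t /\ t <= r by move: tr; rewrite in_itv /= => /andP[].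
have : Num.max (t - e) (- r) < Num.min (t + e) r.
  rewrite gt_max !lt_min; apply/andP; split; apply/andP; split; lra.
move=> /rat_in_itvoo[q]; rewrite in_itv /= gt_max lt_min.
move=> /andP[/andP[q1 q2] /andP[q3 q4]]; exists q.
  by rewrite in_itv /= !ltW.
by apply: He; rewrite /ball /= ltr_norml; apply/andP; split; lra.
Qed.

Lemma measurable_modc (R : realType) d (T : measurableType d) (Y : T -> R[i]) :
  cbmeas Y -> measurable_fun setT (fun w => modc (Y w)).
Proof.
move=> [[mr _] [mi _]].
have -> : (fun w => modc (Y w)) =
   Num.sqrt \o (fun w => complex.Re (Y w) ^+ 2 + complex.Im (Y w) ^+ 2).
  by apply/funext => w; rewrite modcE.
apply: (measurableT_comp (continuous_measurable_fun (@sqrt_continuous R))).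
by apply: measurable_realfun.measurable_funD; exact: measurable_funX.
Qed.

Section events.
Context (R : realType) d (T : measurableType d) (P : probability T R)
  (Xs : nat -> {RV P >-> R}) (lam : R) (h : nat -> R).
Hypothesis h_gt0 : forall n, 0 < h n.

Let rn n : 0 < (h n)^-1. Proof. by rewrite invr_gt0. Qed.

Lemma cbmeas_emp n (t : R) : cbmeas (fun w => emp_char_fun (Xs ^~ w) n t).
Proof.
under eq_fun do rewrite emp_char_funE.
apply: cbmeasM; first exact: cbmeas_cst.
apply: (@cbmeas_sum _ T R _ _ (fun (j : 'I_n) w => cis (t * Xs j w))) => j.
by apply: cbmeas_cis; exact: measurable_funM.
Qed.

(** By compactness and continuity, nonvanishing on the interval amounts to a
    uniform positive lower bound at the rational points. *)
Lemma measurable_dlog_event n : measurable (dlog_event Xs lam h n).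
Proof.
case: n => [|m].
  rewrite (_ : dlog_event _ _ _ _ = set0) //; apply/seteqP; split => // w.
  by move=> /(dlog_well_definedP lam (Xs ^~ w) 0 (h_gt0 0))[].
pose E (k : nat) (q : rat) := [set w | (ratr q : R) \in `[- (h m.+1)^-1, (h m.+1)^-1] ->
  k.+1%:R^-1 <= modc (emp_char_fun (Xs ^~ w) m.+1 (ratr q))].
have mE k q : measurable (E k q).
  rewrite /E; have [qr|qr] := boolP ((ratr q : R) \in `[- (h m.+1)^-1, (h m.+1)^-1]).
    have := measurable_fun_le measurableT (measurable_cst (k.+1%:R^-1 : R))
      (measurable_modc (cbmeas_emp m.+1 (ratr q))).
    by rewrite setTI; congr measurable; apply/seteqP; split => w //=; apply.
  rewrite (_ : [set w | _] = setT) //.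
  by apply/seteqP; split.
rewrite (_ : dlog_event _ _ _ _ = \bigcup_k (\bigcap_q E k q)).
  apply: bigcupT_measurable => k; rewrite -[X in measurable X]setCK setC_bigcap.
  apply: measurableC; apply: bigcupT_measurable_rat => q.
  by apply: measurableC; exact: mE.
apply/seteqP; split => w.
- move=> /(dlog_well_definedP lam (Xs ^~ w) m.+1 (h_gt0 m.+1))[_ emp0].
  have rr : - (h m.+1)^-1 <= (h m.+1)^-1.
    by rewrite -subr_ge0 opprK addr_ge0 // ltW.
  have [c cr gc] := @EVT_min R _ _ _ rr
    (continuous_subspaceT (@modc_emp_continuous R (Xs ^~ w) m.+1)).
  have c0 : 0 < modc (emp_char_fun (Xs ^~ w) m.+1 c) by rewrite modc_gt0 emp0.
  exists (Num.truncn (modc (emp_char_fun (Xs ^~ w) m.+1 c))^-1) => //.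
  move=> q _ /= qr; apply: le_trans (gc _ qr).
  by rewrite -[leRHS]invrK lef_pV2 ?posrE ?invr_gt0 // ltW // truncnS_gt.
- move=> [k _ Ek]; apply/(dlog_well_definedP lam (Xs ^~ w) m.+1 (h_gt0 m.+1)).
  split=> // t tr; apply/negP => /eqP t0.
  have k0 : modc (emp_char_fun (Xs ^~ w) m.+1 t) < k.+1%:R^-1.
    by rewrite t0 modc0 invr_gt0.
  have [q qr] := rat_dense_lt (rn m.+1) (@modc_emp_continuous R (Xs ^~ w) m.+1) tr k0.
  by rewrite ltNge (Ek q I qr).
Qed.

Lemma B_eventP (phi : R -> R[i]) (delta : R) n w :
  B_event Xs phi lam delta h n w <->
  exists2 t, t \in `[- (h n)^-1, (h n)^-1] &
    delta < expR (1 / (2 * h n ^+ 2)) *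
      (expR lam * modc (emp_char_fun (Xs ^~ w) n t - phi t)).
Proof.
have E t : modc (emp_char_fun (Xs ^~ w) n t / (expR (- lam))%:C%C -
      phi t / (expR (- lam))%:C%C) =
    expR lam * modc (emp_char_fun (Xs ^~ w) n t - phi t).
  rewrite -mulrBl modcM modcV modc_real ger0_norm ?expR_ge0 //.
  by rewrite expRN invrK mulrC.
split.
- move=> /ereal_sup_gt[_ [t tr <-]]; rewrite lte_fin E => dt.
  by exists t.
- move=> [t tr dt]; rewrite /B_event /=.
  apply: (@lt_le_trans _ _ (expR (1 / (2 * h n ^+ 2)) *
      (expR lam * modc (emp_char_fun (Xs ^~ w) n t - phi t)))%:E).
    by rewrite lte_fin.
  by apply: ereal_sup_ubound; exists t => //; rewrite E.
Qed.

Lemma measurable_B_event (phi : R -> R[i]) (K delta : R) n :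
  (forall s t, modc (phi t - phi s) <= K * `|t - s|) ->
  measurable (B_event Xs phi lam delta h n).
Proof.
move=> phiK.
pose F w t := expR (1 / (2 * h n ^+ 2)) *
      (expR lam * modc (emp_char_fun (Xs ^~ w) n t - phi t)).
pose E (q : rat) := [set w | (ratr q : R) \in `[- (h n)^-1, (h n)^-1] /\
  delta < F w (ratr q)].
rewrite (_ : B_event _ _ _ _ _ _ = \bigcup_q E q).
  apply: bigcupT_measurable_rat => q; rewrite /E.
  have [qr|qr] := boolP ((ratr q : R) \in `[- (h n)^-1, (h n)^-1]).
    have mF : measurable_fun setT (F ^~ (ratr q)).
      apply: measurable_funM => //; apply: measurable_funM => //.
      by apply: measurable_modc; apply: cbmeasB; [exact: cbmeas_emp|exact: cbmeas_cst].
    have := measurableC (measurable_fun_le measurableT mF (measurable_cst delta)).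
    rewrite setTI; congr measurable; apply/seteqP; split => w /=.
      by move=> /negP; rewrite -ltNge.
    by move=> [_ dF]; apply/negP; rewrite -ltNge.
  rewrite (_ : [set w | _] = set0) //.
  by apply/seteqP; split => // w [].
apply/seteqP; split => w.
- move=> /B_eventP[t tr dt].
  have cF : continuous (fun t => - F w t).
    have cD : continuous (fun t => modc (emp_char_fun (Xs ^~ w) n t - phi t)).
      pose Ke := 2 * (n%:R^-1 * \sum_(j < n) `|Xs j w|).
      apply: (@lipschitz_continuous _ _ (Ke + K)) => s u.
      apply: (@le_trans _ _ (modc ((emp_char_fun (Xs ^~ w) n u - phi u) -
                                   (emp_char_fun (Xs ^~ w) n s - phi s)))).
        exact: modc_dist.
      have -> : (emp_char_fun (Xs ^~ w) n u - phi u) -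
                                   (emp_char_fun (Xs ^~ w) n s - phi s) =
         (emp_char_fun (Xs ^~ w) n u - emp_char_fun (Xs ^~ w) n s) - (phi u - phi s).
        by ring.
      rewrite (le_trans (modcD _ _)) // modcN mulrDl lerD //.
      exact: emp_char_fun_lipschitz.
    by move=> u; apply: cvgN; do 2 (apply: cvgMl_tmp); exact: cD.
  have Ft : - F w t < - delta by rewrite ltrN2.
  have [q qr Fq] := rat_dense_lt (rn n) cF tr Ft.
  by exists q => //; split=> //; rewrite -ltrN2.
- by move=> [q _ [qr dq]]; apply/B_eventP; exists (ratr q).
Qed.

(** Off [B], [emp_char_fun] is within [delta * exp (- lam) * exp (- 1 / (2 h ^ 2))]
    of [phi], hence within [delta * exp (- lam) * exp (- t ^ 2 / 2)], and [phi]
    itself is at least [exp (- 2 lam) * exp (- t ^ 2 / 2)]. *)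
Lemma emp_lower_off_B (phi : R -> R[i]) (delta : R) n w t :
  (forall t, expR (- lam) * expR (- lam) * expR (- (t ^+ 2 / 2)) <= modc (phi t)) ->
  0 < delta -> ~ B_event Xs phi lam delta h n w ->
  t \in `[- (h n)^-1, (h n)^-1] ->
  expR (- lam) - delta <=
    modc (emp_char_fun (Xs ^~ w) n t * (expR lam * expR (t ^+ 2 / 2))%:C%C).
Proof.
move=> phil d0 nB tr.
set D := modc (emp_char_fun (Xs ^~ w) n t - phi t).
have HD : expR (1 / (2 * h n ^+ 2)) * (expR lam * D) <= delta.
  rewrite leNgt; apply/negP => dD; apply: nB; apply/B_eventP.
  by exists t.
have th : expR (t ^+ 2 / 2) <= expR (1 / (2 * h n ^+ 2)).
  have -> : 1 / (2 * h n ^+ 2) = (h n)^-1 ^+ 2 / 2 by field; rewrite gt_eqF.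
  rewrite ler_expR ler_pM2r ?invr_gt0 // -[leLHS]real_normK ?num_real //.
  rewrite lerXn2r ?nnegrE ?(ltW (rn n)) //.
  by move: tr; rewrite in_itv /= -ler_norml.
rewrite modcM modc_real ger0_norm; last by rewrite mulr_ge0 ?expR_ge0.
have H1 : expR (- lam) * expR (- lam) * expR (- (t ^+ 2 / 2)) - D <=
    modc (emp_char_fun (Xs ^~ w) n t).
  rewrite lerBlDr (le_trans (phil t)) // /D modc_distC addrC -lerBlDr; exact: modcB.
have e0 : 0 <= expR lam * expR (t ^+ 2 / 2) by rewrite mulr_ge0 ?expR_ge0.
apply: le_trans (ler_wpM2r e0 H1); rewrite mulrBl.
have -> : expR (- lam) * expR (- lam) * expR (- (t ^+ 2 / 2)) *
    (expR lam * expR (t ^+ 2 / 2)) = expR (- lam).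
  by rewrite -!expRD; congr expR; ring.
rewrite lerD2l lerN2; apply: le_trans HD.
rewrite [leRHS]mulrA [expR _ * expR lam]mulrC [leLHS]mulrC.
by rewrite ler_wpM2r ?modc_ge0 // ler_wpM2l ?expR_ge0.
Qed.

End events.

Lemma char_fun_lipschitz (R : realType) d (T : measurableType d)
    (P : probability T R) (X : T -> R) (s t : R) :
  measurable_fun setT X -> P.-integrable setT (EFin \o X) ->
  modc (char_fun P X t - char_fun P X s) <=
  2 * (\int[P]_w `|X w|) * `|t - s|.
Proof.
move=> mX iX; have bc u : cbmeas (fun w => cis (u * X w)).
  by apply: cbmeas_cis; exact: measurable_funM.
have iaX := integrable_norm iX.
rewrite !char_funE -cexpectB //.
rewrite mulrAC -RintegralZl //; apply: modc_cexpect; first exact: cbmeasB.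
  exact: (integrableZl measurableT _ iaX).
move=> w; rewrite (le_trans (cis_lipschitz _ _)) //.
by rewrite -mulrBl normrM mulrA.
Qed.

(** * Uniform deviation of the empirical characteristic function *)

Lemma union_bound (R : realType) d (T : measurableType d) (P : probability T R)
    (I : finType) (A : set T) (B : I -> set T) :
  measurable A -> (forall i, measurable (B i)) ->
  (forall w, A w -> exists i, B i w) ->
  fine (P A) <= \sum_i fine (P (B i)).
Proof.
move=> mA mB AB; rewrite -int_indic //.
have intS (s : seq I) : \int[P]_w (\sum_(i <- s) \1_(B i) w : R) =
    \sum_(i <- s) fine (P (B i)).
  elim: s => [|i s IH].
    by under eq_Rintegral do rewrite big_nil; rewrite prob_cst big_nil.
  under eq_Rintegral do rewrite big_cons.
  rewrite bmeas_intD; [|exact: bmeas_indic|].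
    by rewrite IH int_indic // big_cons.
  by apply: (@bmeas_sum _ T R _ s (fun i w => \1_(B i) w)) => j; exact: bmeas_indic.
rewrite -intS; apply: le_bmeas_int; first exact: bmeas_indic.
  by apply: (@bmeas_sum _ T R _ _ (fun i w => \1_(B i) w)) => j; exact: bmeas_indic.
move=> w; rewrite indicE; have [/set_mem Aw|_] := boolP (w \in A); last first.
  by apply: sumr_ge0 => i _; rewrite indicE.
have [i Bi] := AB w Aw; rewrite (bigD1 i) //= indicE mem_set //.
by rewrite lerDl; apply: sumr_ge0 => j _; rewrite indicE.
Qed.

Section deviation.
Context (R : realType) d (T : measurableType d) (P : probability T R)
  d0 (T0 : measurableType d0) (P0 : probability T0 R)
  (Xs : nat -> {RV P >-> R}) (X : T0 -> R).
Hypotheses (mX : measurable_fun setT X) (iid : iid_copies P0 Xs X)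
  (iX : P0.-integrable setT (EFin \o X)).

Let phi := char_fun P0 X.
Let EX := \int[P0]_w `|X w|.

Let mXs j : measurable_fun setT (Xs j). Proof. exact: measurable_funP. Qed.
Let XsF j (A : set R) : measurable A -> g_sigma_algebra_preimage (Xs j) (Xs j @^-1` A).
Proof. by move=> mA; exists A => //; rewrite setTI. Qed.

Let EX_ge0 : 0 <= EX. Proof. by apply: Rintegral_ge0. Qed.

Let indX := iid.1.
Let lawX := iid.2.

Let upper (g : R -> R) (eta : R) n :
  measurable_fun setT g -> (forall y, `|g y| <= 1) -> 0 <= eta -> eta <= 4 ->
  fine (P [set w | n%:R * eta <= \sum_(j < n) (g (Xs j w) - \int[P0]_w g (X w))]) <=
  expR (- (n%:R * eta ^+ 2 / 32)).
Proof.
move=> mg g1 e0 e4; have bg : bmeas g by split => //; exists 1.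
apply: (hoeffding_upper indX mXs XsF) => // j.
exact: (same_law_int (mXs j) mX bg (lawX j)).
Qed.

Let measurable_sumg (g : R -> R) (c m : R) n : measurable_fun setT g ->
  measurable [set w | c <= \sum_(j < n) (g (Xs j w) - m)].
Proof.
move=> mg; have := measurable_fun_le measurableT (measurable_cst c)
  (@measurable_sum _ T R setT _ (index_enum 'I_n) (fun j w => g (Xs j w) - m) _).
rewrite setTI; apply => j; apply: measurable_funB => //.
exact: measurableT_comp.
Qed.

Let measurable_dev t (c : R) n :
  measurable [set w | c < modc (emp_char_fun (Xs ^~ w) n t - phi t)].
Proof.
have mF : measurable_fun setT (fun w => modc (emp_char_fun (Xs ^~ w) n t - phi t)).
  by apply: measurable_modc; apply: cbmeasB; [exact: cbmeas_emp|exact: cbmeas_cst].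
have := measurableC (measurable_fun_le measurableT mF (measurable_cst c)).
rewrite setTI; congr measurable; apply/seteqP; split => w /=.
  by move=> /negP; rewrite -ltNge.
by move=> dF; apply/negP; rewrite -ltNge.
Qed.

(** A deviation larger than [2 * eta] of a complex number forces one of its two
    coordinates to deviate by at least [eta], in one of the two directions. *)
Lemma pointwise_deviation (t eta : R) n : (0 < n)%N -> 0 <= eta -> eta <= 4 ->
  fine (P [set w | 2 * eta < modc (emp_char_fun (Xs ^~ w) n t - phi t)]) <=
  4 * expR (- (n%:R * eta ^+ 2 / 32)).
Proof.
move=> n0 e0 e4.
pose G (i : 'I_4) : R -> R := nth (fun=> 0) [:: fun y => cos (t * y);
  fun y => - cos (t * y); fun y => sin (t * y); fun y => - sin (t * y)] i.
have mlin : measurable_fun setT (fun y : R => t * y) by exact: measurable_funM.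
have [mc _] := bmeas_cos mlin; have [ms _] := bmeas_sin mlin.
have mG i : measurable_fun setT (G i).
  case: i => [[|[|[|[|//]]]]] i4 //=; rewrite /G /=.
  - exact: measurable_funN.
  - exact: measurable_funN.
have G1 i y : `|G i y| <= 1.
  case: i => [[|[|[|[|//]]]]] i4 //=; rewrite /G /= ?normrN ?cos_max ?sin_max //.
apply: (@le_trans _ _ (\sum_(i < 4) fine (P [set w | n%:R * eta <=
    \sum_(j < n) (G i (Xs j w) - \int[P0]_w G i (X w))]))); last first.
  have -> : 4 * expR (- (n%:R * eta ^+ 2 / 32)) =
      \sum_(i < 4) expR (- (n%:R * eta ^+ 2 / 32)).
    by rewrite sumr_const card_ord mulr_natl.
  by apply: ler_sum => i _; exact: upper.
apply: union_bound => //; first by move=> i; exact: measurable_sumg.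
move=> w /= dw.
have nr0 : 0 < n%:R :> R by rewrite ltr0n.
have ReE : n%:R * complex.Re (emp_char_fun (Xs ^~ w) n t - phi t) =
    \sum_(j < n) (cos (t * Xs j w) - \int[P0]_w cos (t * X w)).
  rewrite cReD cReN emp_char_funE natC invC cReZ cRe_sum mulrBr mulVKf ?gt_eqF //.
  rewrite sumrB sumr_const card_ord mulr_natl; congr (_ - _ *+ n).
  by rewrite /phi char_funE cexpectE.
have ImE : n%:R * complex.Im (emp_char_fun (Xs ^~ w) n t - phi t) =
    \sum_(j < n) (sin (t * Xs j w) - \int[P0]_w sin (t * X w)).
  rewrite cImD cImN emp_char_funE natC invC cImZ cIm_sum mulrBr mulVKf ?gt_eqF //.
  rewrite sumrB sumr_const card_ord mulr_natl; congr (_ - _ *+ n).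
  by rewrite /phi char_funE cexpectE.
have neg (g : R -> R) : bmeas g ->
    \sum_(j < n) (- g (Xs j w) - \int[P0]_w - g (X w)) =
    - \sum_(j < n) (g (Xs j w) - \int[P0]_w g (X w)).
  move=> bg; rewrite -sumrN; apply: eq_bigr => j _; rewrite opprB addrC.
  have bgX := bmeas_comp mX bg.
  under eq_Rintegral do rewrite -mulN1r.
  by rewrite bmeas_intZ // mulN1r opprK.
have := lt_le_trans dw (modc_le_ReIm _).
set a := complex.Re _ in ReE *; set b := complex.Im _ in ImE *.
move=> ab; have [ae|ae] := leP eta `|a|.
  move: ae; rewrite ler_normr => /orP[ae|ae].
  - by exists (@Ordinal 4 0 isT); rewrite /G /= -ReE ler_pM2l.
  - exists (@Ordinal 4 1 isT); rewrite /G /= (neg (fun y => cos (t * y))) -?ReE; last first.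
      exact: bmeas_cos.
    by rewrite -mulrN ler_pM2l.
have : eta <= `|b| by lra.
rewrite ler_normr => /orP[be|be].
- by exists (@Ordinal 4 2 isT); rewrite /G /= -ImE ler_pM2l.
- exists (@Ordinal 4 3 isT); rewrite /G /= (neg (fun y => sin (t * y))) -?ImE; last first.
    exact: bmeas_sin.
  by rewrite -mulrN ler_pM2l.
Qed.

Let eXs j : (\int[P]_w `|(Xs j w)%:E| = \int[P0]_w `|(X w)%:E|)%E.
Proof.
apply: (same_law_ge0_integral (g := fun y => `|y%:E|%E) (mXs j) mX _ _ (lawX j)) => //.
by apply: measurableT_comp => //.
Qed.

Let iXs j : P.-integrable setT (EFin \o Xs j).
Proof.
apply/integrableP; split; first exact/measurable_EFinP.
by rewrite /= eXs; have /integrableP[] := iX.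
Qed.

Let EXs j : \int[P]_w `|Xs j w| = EX.
Proof. by rewrite /EX /Rintegral -[in LHS]/(fine (\int[P]_w `|(Xs j w)%:E|)%E) eXs. Qed.

Let avg n w : R := n%:R^-1 * \sum_(j < n) `|Xs j w|.

(** Markov's inequality for the average of the [`|Xs j|], whose expectation is
    that of [`|X|]. *)
Let markov_avg n (A : R) : (0 < n)%N -> 0 < A ->
  measurable [set w | A < avg n w] /\ fine (P [set w | A < avg n w]) <= EX / A.
Proof.
move=> n0 A0.
have iabs j := integrable_norm (iXs j).
have isum (s : seq nat) : P.-integrable setT (EFin \o (fun w => \sum_(j <- s) `|Xs j w|)) /\
    \int[P]_w (\sum_(j <- s) `|Xs j w|) = \sum_(j <- s) EX.
  elim: s => [|j s [IH1 IH2]].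
    have -> : (fun w => \sum_(j <- [::]) `|Xs j w|) = (fun=> 0).
      by apply/funext => w; rewrite big_nil.
    by split; [exact/bmeas_integrable/bmeas_cst|rewrite prob_cst big_nil].
  have -> : (fun w => \sum_(j <- j :: s) `|Xs j w|) =
      (fun w => `|Xs j w| + \sum_(j <- s) `|Xs j w|).
    by apply/funext => w; rewrite big_cons.
  split; last first.
    have := RintegralD measurableT (iabs j) IH1.
    by rewrite IH2 big_cons -{2}(EXs j).
  exact: (integrableD measurableT (iabs j) IH1).
have [is1 is2] := isum (iota 0 n).
have avgE w : avg n w = n%:R^-1 * \sum_(j <- iota 0 n) `|Xs j w|.
  by rewrite /avg big_iota0.
have iavg : P.-integrable setT (EFin \o avg n).
  have -> : EFin \o avg n = EFin \o (fun w => n%:R^-1 * \sum_(j <- iota 0 n) `|Xs j w|).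
    by apply/funext => w; rewrite /= avgE.
  exact: (integrableZl measurableT _ is1).
have Eavg : \int[P]_w avg n w = EX.
  under eq_Rintegral do rewrite avgE.
  rewrite RintegralZl // is2 big_iota0 sumr_const card_ord -[EX *+ n]mulr_natl mulKf //.
  by rewrite pnatr_eq0 -lt0n.
have mE : measurable [set w | A < avg n w].
  have /integrableP[/measurable_EFinP mavg _] := iavg.
  have := measurableC (measurable_fun_le measurableT mavg (measurable_cst A)).
  rewrite setTI; congr measurable; apply/seteqP; split => w /=.
    by move=> /negP; rewrite -ltNge.
  by move=> dF; apply/negP; rewrite -ltNge.
split => //; rewrite ler_pdivlMr // mulrC -int_indic // -bmeas_intZ; last exact: bmeas_indic.
rewrite -Eavg; apply: le_Rintegral => //.
  by apply: bmeas_integrable; apply: bmeasZ; exact: bmeas_indic.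
move=> w _; rewrite indicE; have [/set_mem /= /ltW Aw|_] := boolP (w \in _).
  by rewrite mulr1.
rewrite mulr0 /avg mulr_ge0 ?invr_ge0 //; exact: sumr_ge0.
Qed.

(** Between two neighbouring points of a grid of mesh [2 r / M] the deviation
    varies by at most the mesh times its Lipschitz constant, which involves the
    average of the [`|Xs j|]. *)
Lemma uniform_deviation (r eps A : R) (n M : nat) :
  (0 < n)%N -> 0 < r -> 0 < eps -> eps <= 16 -> 0 < A -> (0 < M)%N ->
  (2 * A + 2 * EX) * (2 * r / M%:R) <= eps / 2 ->
  measurable [set w | exists2 t, t \in `[- r, r] &
    eps < modc (emp_char_fun (Xs ^~ w) n t - phi t)] ->
  fine (P [set w | exists2 t, t \in `[- r, r] &
    eps < modc (emp_char_fun (Xs ^~ w) n t - phi t)]) <=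
  EX / A + M.+1%:R * (4 * expR (- (n%:R * (eps / 4) ^+ 2 / 32))).
Proof.
move=> n0 r0 e0 e16 A0 M0 mesh mE.
have [mA PA] := markov_avg n0 A0.
pose tk (k : nat) : R := - r + 2 * r / M%:R * k%:R.
pose B (i : option 'I_M.+1) : set T := if i is Some k then
    [set w | 2 * (eps / 4) < modc (emp_char_fun (Xs ^~ w) n (tk k) - phi (tk k))]
  else [set w | A < avg n w].
have M0' : 0 < M%:R :> R by rewrite ltr0n.
apply: (@le_trans _ _ (\sum_i fine (P (B i)))).
  apply: union_bound => //; first by case=> [k|]; [exact: measurable_dev|].
  move=> w [t tr et]; have [Aw|wA] := ltP A (avg n w); first by exists None.
  (* The coordinate of t on the grid; its integer part is a neighbour of t. *)
  pose y := (t + r) * M%:R / (2 * r).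
  have [t1 t2] : - r <= t /\ t <= r by move: tr; rewrite in_itv /= => /andP[].
  have y0 : 0 <= y.
    by apply: divr_ge0; [apply: mulr_ge0; [lra|exact: ltW]|lra].
  have yM : y <= M%:R.
    rewrite /y ler_pdivrMr ?mulr_gt0 // mulrC ler_pM2l //; lra.
  have kM : (Num.truncn y < M.+1)%N.
    by rewrite ltnS -(ler_nat R) (le_trans _ yM) // truncn_le.
  have ty : t = - r + 2 * r / M%:R * y.
    by rewrite /y; field; rewrite !gt_eqF.
  have dt : `|t - tk (Num.truncn y)| <= 2 * r / M%:R.
    have -> : t - tk (Num.truncn y) = 2 * r / M%:R * (y - (Num.truncn y)%:R).
      by rewrite {1}ty /tk; ring.
    have mesh0 : 0 <= 2 * r / M%:R by apply: divr_ge0; [lra|exact: ltW].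
    rewrite normrM ger0_norm // ler_piMr //.
    have h2 : (Num.truncn y)%:R <= y by rewrite truncn_le.
    have := truncnS_gt y; rewrite -natr1 => h1.
    by rewrite ler_norml; apply/andP; split; lra.
  exists (Some (Ordinal kM)); rewrite /B /=; set s := tk _ in dt *.
  have -> : 2 * (eps / 4) = eps / 2 by field.
  have H1 := emp_char_fun_lipschitz (Xs ^~ w) n s t.
  have H2 := @char_fun_lipschitz R _ _ P0 X t s mX iX.
  have H3 : modc (emp_char_fun (Xs ^~ w) n t - phi t) <=
      modc (emp_char_fun (Xs ^~ w) n t - emp_char_fun (Xs ^~ w) n s) +
      (modc (emp_char_fun (Xs ^~ w) n s - phi s) + modc (phi s - phi t)).
    apply: le_trans (le_trans (modcD _ _) (lerD (lexx _) (modcD _ _))).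
    by rewrite le_eqVlt; apply/orP; left; apply/eqP; congr modc; ring.
  have H4 : (2 * avg n w + 2 * EX) * `|t - s| <= eps / 2.
    have avg0 : 0 <= avg n w by rewrite mulr_ge0 ?invr_ge0 //; exact: sumr_ge0.
    apply: le_trans mesh; apply: ler_pM => //; last by lra.
    by apply: addr_ge0; apply: mulr_ge0 => //; exact: EX_ge0.
  rewrite -/(avg n w) in H1; rewrite distrC -/EX -/phi in H2.
  rewrite mulrDl in H4; lra.
rewrite (bigD1 None) //=; apply: lerD => //.
have e4 : eps / 4 <= 4 by lra.
have e40 : 0 <= eps / 4 by lra.
apply: (@le_trans _ _ (\sum_(i : option 'I_M.+1 | i != None)
    4 * expR (- (n%:R * (eps / 4) ^+ 2 / 32)))).
  by apply: ler_sum => -[k|//] _; exact: pointwise_deviation.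
by rewrite sumr_const cardC1 card_option card_ord [leRHS]mulr_natl.
Qed.

End deviation.

(** * The bandwidth and the rate of decay *)

Lemma expRN_le_pow (R : realType) (k : nat) (y : R) :
  0 < y -> expR (- y) <= k`!%:R / y ^+ k.
Proof.
move=> y0; have yk : 0 < y ^+ k by rewrite exprn_gt0.
have kf : 0 < k`!%:R :> R by rewrite ltr0n fact_gt0.
rewrite expRN -[leRHS]invf_div lef_pV2 ?posrE ?expR_gt0 ?divr_gt0 //.
apply: le_trans (texp_le_expR k.+1 (ltW y0)).
rewrite /texp big_ord_recr /= lerDr; apply: sumr_ge0 => i _.
by rewrite divr_ge0 ?exprn_ge0 // ltW.
Qed.

(** The bandwidth is so large that [exp (1 / (2 h ^ 2))] is at most a small power
    of [n]: since [2 beta < 1], [h ^ -2] is negligible against [ln n]. *)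
Lemma bandwidth_subpolynomial (R : realType) (h : nat -> R) (beta : R) :
  (forall n, 0 < h n) -> 0 < beta < 1 / 2 ->
  h ~_\oo (fun n => ln n%:R `^ (- beta)) ->
  \forall n \near \oo, expR (1 / (2 * h n ^+ 2)) ^+ 4 <= n%:R.
Proof.
move=> h0 /andP[b0 b2] /eqaddoP/(_ (1 / 2)) hb.
have {hb} hb : \forall n \near \oo,
    `|h n - ln n%:R `^ (- beta)| <= 1 / 2 * `|ln n%:R `^ (- beta)|.
  by apply: hb; rewrite divr_gt0.
pose g := 1 - 2 * beta.
have g0 : 0 < g by rewrite /g; lra.
pose L : R := 8 `^ g^-1.
have L0 : 0 < L by rewrite powR_gt0.
near=> n.
have nL : L <= ln n%:R.
  have : expR L <= n%:R by near: n; exact: nbhs_infty_ger.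
  move=> eL; have n0 : 0 < n%:R :> R by rewrite (lt_le_trans _ eL) // expR_gt0.
  by rewrite -(expRK L) ler_ln ?posrE ?expR_gt0.
have l0 : 0 < ln n%:R :> R by rewrite (lt_le_trans L0).
have n0 : 0 < n%:R :> R.
  rewrite ltNge; apply/negP => n0; move: l0.
  by rewrite ltNge ln_le0 // (le_trans n0).
have hn0 : `|h n - ln n%:R `^ (- beta)| <= 1 / 2 * `|ln n%:R `^ (- beta)| by near: n.
set l := ln n%:R in nL l0 hn0.
have hn : 1 / 2 * l `^ (- beta) <= h n.
  move: hn0; rewrite (ger0_norm (powR_ge0 _ _)) ler_norml => /andP[H _].
  by move: H; move: (l `^ (- beta)) => p; lra.
have lb0 : 0 < l `^ beta by rewrite powR_gt0.
have hV : (h n)^-1 <= 2 * l `^ beta.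
  rewrite -[leRHS]invrK lef_pV2 ?posrE ?invr_gt0 ?mulr_gt0 //.
  by rewrite invfM -powRN; move: hn; rewrite mul1r.
have E : expR (1 / (2 * h n ^+ 2)) ^+ 4 = expR (2 * (h n)^-1 ^+ 2).
  rewrite -expRM_natl; congr expR; field; rewrite gt_eqF //.
rewrite E -[leRHS]lnK ?posrE // ler_expR -/l.
apply: (@le_trans _ _ (8 * (l `^ beta) ^+ 2)).
  have : (h n)^-1 ^+ 2 <= (2 * l `^ beta) ^+ 2.
    by rewrite lerXn2r ?nnegrE ?invr_ge0 ?(ltW (h0 n)) // mulr_ge0 // ltW.
  by rewrite exprMn; move: (_ ^+ 2) ((l `^ beta) ^+ 2) => p q; lra.
have -> : (l `^ beta) ^+ 2 = l `^ (2 * beta).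
  by rewrite -powR_mulrn ?powR_ge0 // -powRrM mulrC.
have lE : l = l `^ g * l `^ (2 * beta).
  rewrite -powRD; last by apply/implyP => _; rewrite gt_eqF.
  by rewrite /g subrK powRr1 // ltW.
rewrite [leRHS]lE ler_wpM2r ?powR_ge0 //.
have -> : 8 = L `^ g by rewrite /L -powRrM mulVf ?gt_eqF // powRr1.
by rewrite ge0_ler_powR ?nnegrE // ltW.
Unshelve. all: by end_near. Qed.

Section rate.
Context (R : realType) d (T : measurableType d) (P : probability T R)
  d0 (T0 : measurableType d0) (P0 : probability T0 R)
  (Xs : nat -> {RV P >-> R}) (X : T0 -> R) (lam : R) (h : nat -> R).
Hypotheses (mX : measurable_fun setT X) (iid : iid_copies P0 Xs X)
  (iX : P0.-integrable setT (EFin \o X)) (h_gt0 : forall n, 0 < h n)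
  (h_sub : \forall n \near \oo, expR (1 / (2 * h n ^+ 2)) ^+ 4 <= n%:R)
  (lam0 : 0 < lam).

Let phi := char_fun P0 X.
Let EX := \int[P0]_w `|X w|.

Lemma measurable_B delta n : measurable (B_event Xs phi lam delta h n).
Proof.
apply: (@measurable_B_event _ _ _ _ _ _ _ h_gt0 _ (2 * EX)) => s t.
exact: char_fun_lipschitz.
Qed.

Lemma le_prob_B delta delta' n : delta' <= delta ->
  fine (P (B_event Xs phi lam delta h n)) <= fine (P (B_event Xs phi lam delta' h n)).
Proof.
move=> dd; apply: fine_le; rewrite ?fin_num_measure //; try exact: measurable_B.
apply: le_measure; rewrite ?inE; try exact: measurable_B.
move=> w /B_eventP[t tr dt]; apply/B_eventP; exists t => //.
exact: le_lt_trans dt.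
Qed.

(** With [E = exp (1 / (2 h ^ 2))], [B] is the event that the deviation exceeds
    [eps = c1 / E] somewhere. The deviation bound is used with [A = n ^ K] and a
    grid of [O(n ^ (K + 1))] points; since [n * eps ^ 2] is at least of order
    [sqrt n], the exponential beats every power of [n]. *)
Lemma B_rate (K : nat) (delta : R) : 0 < delta ->
  exists2 C : R, 0 <= C & \forall n \near \oo,
    fine (P (B_event Xs phi lam delta h n)) <= C / n%:R ^+ K.
Proof.
move=> delta0.
have EX0 : 0 <= EX by apply: Rintegral_ge0.
(* Capping delta at 1 keeps eps in the range of the deviation bound. *)
pose dl := Num.min delta 1; pose c1 := dl * expR (- lam).
have dl0 : 0 < dl by rewrite lt_min delta0 ltr01.
have c10 : 0 < c1 by rewrite mulr_gt0 ?expR_gt0.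
have c11 : c1 <= 1.
  by rewrite -[1]mulr1 ler_pM ?expR_ge0 ?(ltW dl0) ?ge_min ?lexx ?orbT //
    -[leRHS]expR0 ler_expR oppr_le0 ltW.
(* n ^- m absorbs the n ^ (K + 1) grid points and still leaves n ^- K. *)
pose m := (2 * K).+1.
have [c2 c20 c2E] : exists2 c2 : R, 0 < c2 & c2 = ((c1 / 4) ^+ 2 / 32) ^+ 2.
  exists (((c1 / 4) ^+ 2 / 32) ^+ 2) => //.
  by apply: exprn_gt0; apply: divr_gt0 => //; apply: exprn_gt0; exact: divr_gt0.
pose C1 := 8 * (1 + EX) / c1 + 2.
have C10 : 0 <= C1 by rewrite addr_ge0 // divr_ge0 ?(ltW c10) // mulr_ge0 // addr_ge0.
pose C3 := C1 * (4 * ((2 * m)`!%:R / c2 ^+ m)).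
have C30 : 0 <= C3 by rewrite mulr_ge0 // mulr_ge0 // divr_ge0 // exprn_ge0 // ltW.
exists (EX + C3); first exact: addr_ge0.
near=> n.
have n1 : (0 < n)%N by near: n; exact: nbhs_infty_gt.
have n1R : 1 <= n%:R :> R by rewrite ler1n.
have n0R : 0 < n%:R :> R by rewrite ltr0n.
have En : expR (1 / (2 * h n ^+ 2)) ^+ 4 <= n%:R by near: n.
pose r := (h n)^-1; set E := expR (1 / (2 * h n ^+ 2)) in En.
have r0 : 0 < r by rewrite invr_gt0.
have rE : 1 + r ^+ 2 / 2 <= E.
  have -> : r ^+ 2 / 2 = 1 / (2 * h n ^+ 2) by rewrite /r; field; rewrite gt_eqF.
  exact: expR_ge1Dx.
have E1 : 1 <= E by apply: le_trans rE; rewrite lerDl divr_ge0 // sqr_ge0.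
have E0 : 0 < E by exact: expR_gt0.
have rleE : r <= E.
  by apply: le_trans rE; have := sqr_ge0 (r - 1); rewrite sqrrB expr1n; lra.
have E2n : E ^+ 2 <= n%:R.
  by apply: le_trans En; rewrite ler_weXn2l.
apply: (le_trans (@le_prob_B delta dl n _)); first by rewrite ge_min lexx.
pose eps := c1 / E.
have eps0 : 0 < eps by rewrite divr_gt0.
have epsE : B_event Xs phi lam dl h n = [set w | exists2 t, t \in `[- r, r] &
    eps < modc (emp_char_fun (Xs ^~ w) n t - phi t)].
  apply/seteqP; split => w.
    move=> /B_eventP[t tr dt]; exists t => //; move: dt; rewrite -/E /eps /c1.
    move: (modc _) => D; rewrite ltr_pdivrMr // expRN ltr_pdivrMr ?expR_gt0 //.
    by rewrite (_ : D * E * expR lam = E * (expR lam * D)) //; ring.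
  move=> [t tr dt]; apply/B_eventP; exists t => //; move: dt; rewrite -/E /eps /c1.
  move: (modc _) => D; rewrite ltr_pdivrMr // expRN ltr_pdivrMr ?expR_gt0 //.
  by rewrite (_ : D * E * expR lam = E * (expR lam * D)) //; ring.
have mB := @measurable_B dl n; rewrite epsE in mB *.
pose A : R := n%:R ^+ K.
have A1 : 1 <= A by rewrite exprn_ege1.
have A0 : 0 < A by rewrite (lt_le_trans ltr01).
pose Q := (2 * A + 2 * EX) * (4 * r) / eps.
have Q0 : 0 <= Q.
  rewrite divr_ge0 ?(ltW eps0) // mulr_ge0 //; last by rewrite mulr_ge0 // ltW.
  by rewrite addr_ge0 // mulr_ge0 // ltW.
pose M := (Num.truncn Q).+1.
have M0 : (0 < M)%N by [].
have MR0 : 0 < M%:R :> R by rewrite ltr0n.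
have QM : Q <= M%:R by rewrite ltW // truncnS_gt.
have mesh : (2 * A + 2 * EX) * (2 * r / M%:R) <= eps / 2.
  rewrite !mulrA ler_pdivrMr //.
  have := QM; rewrite /Q ler_pdivrMr // => H; lra.
have e16 : eps <= 16.
  rewrite /eps ler_pdivrMr //; lra.
apply: le_trans (uniform_deviation mX iid iX n1 r0 eps0 e16 A0 M0 mesh mB) _.
rewrite -/EX [leRHS]mulrDl -/A lerD2l.
pose y := n%:R * (eps / 4) ^+ 2 / 32.
have y0 : 0 < y by rewrite divr_gt0 // mulr_gt0 // exprn_gt0 // divr_gt0.
(* Because E ^ 4 <= n, the exponent y is at least of order sqrt n. *)
have y2 : c2 * n%:R <= y ^+ 2.
  have -> : y ^+ 2 = c2 * (n%:R ^+ 2 / E ^+ 4).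
    by rewrite /y /eps c2E; field; rewrite gt_eqF.
  rewrite ler_pM2l // ler_pdivlMr ?exprn_gt0 // expr2 ler_pM2l //.
have expy : expR (- y) <= (2 * m)`!%:R / c2 ^+ m / n%:R ^+ m.
  apply: (le_trans (expRN_le_pow (2 * m) y0)).
  rewrite -mulrA ler_pM2l ?ltr0n ?fact_gt0 // -invfM -exprMn exprM.
  have cn0 : 0 < c2 * n%:R by exact: mulr_gt0.
  have y20 : 0 < y ^+ 2 by exact: exprn_gt0.
  rewrite lef_pV2 ?posrE; [|exact: exprn_gt0..].
  by rewrite lerXn2r ?nnegrE ?(ltW cn0) ?(ltW y20).
have M1 : M.+1%:R <= C1 * n%:R ^+ K.+1.
  have MQ : M.+1%:R <= Q + 2.
    have : (Num.truncn Q)%:R <= Q by rewrite truncn_le.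
    by rewrite /M -!natr1; lra.
  apply: (le_trans MQ).
  have nK1 : 1 <= n%:R ^+ K.+1 :> R by rewrite exprn_ege1.
  have QK : Q <= 8 * (1 + EX) / c1 * n%:R ^+ K.+1.
    have -> : Q = 8 * (A + EX) / c1 * (r * E).
      by rewrite /Q /eps; field; rewrite !gt_eqF.
    have rE2 : r * E <= n%:R.
      by apply: le_trans E2n; rewrite expr2 ler_wpM2r // ltW.
    have AK : A + EX <= (1 + EX) * A.
      by rewrite mulrDl mul1r lerD2l ler_peMr.
    rewrite exprSr mulrA ler_pM //.
    + by rewrite divr_ge0 ?(ltW c10) // mulr_ge0 // addr_ge0 // ltW.
    + by rewrite mulr_ge0 ?(ltW r0) ?(ltW E0).
    + by rewrite [leRHS]mulrAC -[X in _ <= X / _]mulrA ler_pM2r ?invr_gt0 // ler_pM2l.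
  by rewrite /C1 mulrDl lerD // -[leLHS]mulr1 ler_wpM2l.
apply: (@le_trans _ _ (C1 * n%:R ^+ K.+1 * (4 * ((2 * m)`!%:R / c2 ^+ m / n%:R ^+ m)))).
  by rewrite ler_pM // ?mulr_ge0 ?expR_ge0 // ler_wpM2l.
rewrite le_eqVlt; apply/orP; left; apply/eqP.
have -> : n%:R ^+ m = n%:R ^+ K.+1 * A :> R.
  by rewrite /A -exprD /m; congr (_ ^+ _); rewrite mulSn mul1n addSn.
rewrite /C3; field; rewrite !gt_eqF ?exprn_gt0 //.
Unshelve. all: by end_near. Qed.

End rate.

Lemma powR_bigO (R : realType) (a C : R) (K : nat) (u : nat -> R) :
  0 <= C -> a <= K%:R -> (forall n, 0 <= u n) ->
  (\forall n \near \oo, u n <= C / n%:R ^+ K) ->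
  u =O_\oo (fun n => 1 / n%:R `^ a).
Proof.
move=> C0 aK u0 uC; apply/eqO_exP; exists (C + 1); first by rewrite ltr_pwDr.
near=> n.
have n1 : 1 <= n%:R :> R by rewrite ler1n; near: n; exact: nbhs_infty_gt.
have n0 : 0 < n%:R :> R by rewrite (lt_le_trans ltr01).
rewrite !ger0_norm ?divr_ge0 ?powR_ge0 //.
have h : u n <= C / n%:R ^+ K by near: n.
apply: (le_trans h); rewrite mul1r ler_pM ?invr_ge0 ?exprn_ge0 ?(ltW n0) ?lerDl //.
rewrite lef_pV2 ?posrE ?exprn_gt0 ?powR_gt0 //.
by rewrite -powR_mulrn ?(ltW n0) // ler_powR.
Unshelve. all: by end_near. Qed.

Theorem proposition2p1 (R : realType) (lam : R) (f : R -> R)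
    (d0 : measure_display) (T0 : measurableType d0) (P0 : probability T0 R)
    (N : {RV P0 >-> nat}) (W : nat -> {RV P0 >-> R}) (Z : {RV P0 >-> R})
    (d : measure_display) (T : measurableType d) (P : probability T R)
    (Xs : nat -> {RV P >-> R}) (h : nat -> R) (beta : R) :
  let X := gauss_compound_sum N (fun j => W j) Z in
  let phiX := char_fun P0 X in
  let B := fun delta => B_event Xs phiX lam delta h in
  0 < lam -> is_density f ->
  gauss_compound_poisson_model lam f N W Z ->
  iid_copies P0 Xs X ->
  (forall n, 0 < h n) -> 0 < beta < 1 / 2 ->
  h ~_\oo (fun n => ln n%:R `^ (- beta)) ->
  ('E_P0[fun w => `|X w|%R] < +oo)%E ->
  [/\ (forall n, measurable (dlog_event Xs lam h n)) /\
        (P (dlog_event Xs lam h n) @[n --> \oo] --> 1%E),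
      (forall delta : R, 0 < delta < expR (- lam) ->
        small_delta Xs phiX lam h delta)
    & forall delta : R, 0 < delta -> small_delta Xs phiX lam h delta ->
      [/\ forall n, measurable (B delta n),
          (forall rho : R, 1 < rho < 2 -> ('E_P0[fun w => (`|X w| `^ rho)%R] < +oo)%E ->
            (fun n => fine (P (B delta n))) =O_\oo
              (fun n => 1 / n%:R `^ (rho - 1)))
        & (forall rho : R, 2 <= rho -> ('E_P0[fun w => (`|X w| `^ rho)%R] < +oo)%E ->
            (fun n => fine (P (B delta n))) =O_\oo
              (fun n => 1 / n%:R `^ (rho / 2)))]].

Proof.
move=> X phiX B lam0 dens model iid h0 hb heq EXfin.
have mX : measurable_fun setT X.
  exact: measurable_gauss_compound_sum.
have iX : P0.-integrable setT (EFin \o X).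
  apply/integrableP; split; first exact/measurable_EFinP.
  by move: EXfin; rewrite unlock.
have h_sub := bandwidth_subpolynomial h0 hb heq.
have phil t := char_fun_lower model t lam0.
have mB delta n : measurable (B delta n) by exact: measurable_B.
have rate := B_rate mX iid iX h0 h_sub lam0.
have small (delta : R) : 0 < delta < expR (- lam) -> small_delta Xs phiX lam h delta.
  move=> /andP[d0' dl] n w _ nB; exists (expR (- lam) - delta); first by rewrite subr_gt0.
  by move=> t tr; exact: (emp_lower_off_B h0 phil d0' nB tr).
have rates (delta : R) : 0 < delta -> forall a : R,
    (fun n => fine (P (B delta n))) =O_\oo (fun n => 1 / n%:R `^ a).
  move=> d0' a; have [C C0 HC] := rate (Num.truncn a).+1 delta d0'.
  apply: (powR_bigO C0 _ _ HC); first by rewrite ltW // truncnS_gt.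
  by move=> n; exact/fine_ge0/measure_ge0.
split => //.
- split; first by move=> n; exact: measurable_dlog_event.
  pose delta := expR (- lam) / 2.
  have e0 : 0 < expR (- lam) := expR_gt0 _.
  have d0' : 0 < delta by rewrite divr_gt0.
  have dlt : 0 < delta < expR (- lam) by rewrite d0' /= /delta; lra.
  have [C C0 HC] := rate 1%N delta d0'.
  have mD n : measurable (dlog_event Xs lam h n) by exact: measurable_dlog_event.
  have lower n : (0 < n)%N -> 1 - fine (P (B delta n)) <= fine (P (dlog_event Xs lam h n)).
    move=> n0.
    have -> : 1 - fine (P (B delta n)) = fine (P (~` B delta n)).
      by rewrite probability_setC // fineB // fin_num_measure.
    apply: fine_le; rewrite ?fin_num_measure //; first exact: measurableC.
    apply: le_measure; rewrite ?inE //; first exact: measurableC.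
    move=> w nB; apply/(dlog_well_definedP lam (Xs ^~ w) n (h0 n)); split => // t tr.
    have [c c0 cmod] := small delta dlt n w n0 nB.
    have := lt_le_trans c0 (cmod t tr).
    by rewrite modc_gt0 mulf_eq0 negb_or => /andP[].
  have cv : fine (P (dlog_event Xs lam h n)) @[n --> \oo] --> (1 : R).
    apply: (@squeeze_cvgr _ _ _ _ (fun n => 1 - C / n%:R) (fun=> 1)).
    + near=> n; apply/andP; split.
        have n0 : (0 < n)%N by near: n; exact: nbhs_infty_gt.
        apply: le_trans (lower n n0); rewrite lerD2l lerN2 -[n%:R]expr1.
        by near: n.
      rewrite -[leRHS]/(fine 1%E) fine_le ?fin_num_measure //.
      exact: probability_le1.
    + rewrite -[X in _ --> X](subr0 (1 : R)); apply: cvgB; first exact: cvg_cst.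
      rewrite -[X in _ --> X](mulr0 C); apply: cvgMl_tmp.
      apply/gtr0_cvgV0; last exact: cvgr_idn.
      by near=> n; rewrite ltr0n; near: n; exact: nbhs_infty_gt.
    + exact: cvg_cst.
  apply: cvg_EFin; last exact: cv.
  by apply: nearW => n; exact: fin_num_measure.
- move=> delta d0' _; split => // [rho _ _|rho _ _]; exact: rates.
Unshelve. all: by end_near. Qed.
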